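(* Over binary schemas, the following hold. 1. $(\mathcal{ALCHIU},\mathrm{UCQ})$ has the same expressive power as MDDlog and as $(\mathcal{ALC},\mathrm{UCQ})$. 2. $(\mathcal{S},\mathrm{UCQ})$ and $(\mathcal{ALCF},\mathrm{UCQ})$ are (each) strictly more expressive than $(\mathcal{ALC},\mathrm{UCQ})$.
   Context: **Queries.** A schema $\mathbf{S}$ is a finite set of relation symbols with arities; it is binary if all its symbols have arity one (concept names) or two (role names). An instance $\mathfrak{D}$ over $\mathbf{S}$ is a finite set of facts $R(a_1,\dots,a_n)$, $R\in\mathbf{S}$, with $a_i$ from a fixed countably infinite set of constants; $\mathrm{adom}(\mathfrak{D})$ is the set of constants occurring in $\mathfrak{D}$. An $n$-ary query over $\mathbf{S}$ maps each $\mathbf{S}$-instance $\mathfrak{D}$ to a set $q(\mathfrak{D})\subseteq \mathrm{adom}(\mathfrak{D})^n$. Two queries over $\mathbf{S}$ are equivalent if they agree on all $\mathbf{S}$-instances. A query language is a set of queries. $\mathcal{Q}_2$ is at least as expressive as $\mathcal{Q}_1$ if every query of $\mathcal{Q}_1$ over some schema $\mathbf{S}$ is equivalent to a query of $\mathcal{Q}_2$ over $\mathbf{S}$; they have the same expressive power if this holds in both directions; $\mathcal{Q}_2$ is strictly more expressive than $\mathcal{Q}_1$ if it holds in this direction but not conversely. UCQ is the class of unions of conjunctive queries (without constants; equality allowed). **Ontology-mediated queries.** An ontology language $\mathcal{L}$ is a set of first-order (FO) sentences; an $\mathcal{L}$-ontology $\mathcal{O}$ is a finite set of sentences of $\mathcal{L}$,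 and $\mathrm{sig}(\mathcal{O})$ is the set of its relation symbols. An ontology-mediated query is a triple $(\mathbf{S},\mathcal{O},q)$ with $\mathbf{S}$ a schema (the data schema), $\mathcal{O}$ an ontology and $q$ a query over $\mathbf{S}\cup\mathrm{sig}(\mathcal{O})$. A finite relational structure over a schema is a pair $(\mathrm{dom},\mathfrak{D})$ with $\mathrm{dom}$ a finite non-empty set and $\mathfrak{D}$ an instance over the schema with $\mathrm{adom}(\mathfrak{D})\subseteq\mathrm{dom}$. The triple defines the query over $\mathbf{S}$ that maps $\mathfrak{D}$ to the set of certain answers: all $\mathbf{a}\in\mathrm{adom}(\mathfrak{D})^n$ such that $\mathbf{a}\in q(\mathfrak{D}')$ for every finite relational structure $(\mathrm{dom},\mathfrak{D}')$ over $\mathbf{S}\cup\mathrm{sig}(\mathcal{O})$ that satisfies $\mathcal{O}$ and has $\mathfrak{D}\subseteq\mathfrak{D}'$. $(\mathcal{L},\mathcal{Q})$ denotes the query language of all queries defined by ontology-mediated queries $(\mathbf{S},\mathcal{O},q)$ with $\mathcal{O}$ an $\mathcal{L}$-ontology and $q\in\mathcal{Q}$. **Description logics.** $\mathcal{ALC}$-concepts: $C,D::=A\mid\top\mid\bot\mid\neg C\mid C\sqcap D\mid C\sqcup D\mid\exists R.C\mid\forall R.C$ with $A$ a concept name, $R$ a role name. They translate to FO formulas with one free variable: $A^*(x)=A(x)$; $\top,\bot$ and Booleans as expected; $(\exists R.C)^*(x)=\exists y(R(x,y)\wedge C^*(y))$; $(\forall R.C)^*(x)=\forall y(R(x,y)\to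 C^*(y))$. An $\mathcal{ALC}$-ontology is a finite set of concept inclusions $C\sqsubseteq D$, read as $\forall x(C^*(x)\to D^*(x))$. Extensions: $\mathcal{I}$ additionally allows statements that a role name is the inverse of another, $\forall xy(R(x,y)\leftrightarrow S(y,x))$; $\mathcal{H}$ allows role inclusions $\forall xy(R(x,y)\to S(x,y))$; $\mathcal{U}$ allows in concepts the universal role $U$ (a logical symbol, in no schema), interpreted as $\mathrm{dom}\times\mathrm{dom}$; $\mathcal{F}$ allows statements that a role name is interpreted as a partial function; $\mathcal{S}$ is $\mathcal{ALC}$ extended with statements that a role name is interpreted as a transitive relation. $\mathcal{ALCHIU}$ is $\mathcal{ALC}$ with $\mathcal{H},\mathcal{I},\mathcal{U}$; $\mathcal{ALCF}$ is $\mathcal{ALC}$ with $\mathcal{F}$. **MDDlog.** A disjunctive datalog rule has the form $S_1(\mathbf{x}_1)\vee\cdots\vee S_m(\mathbf{x}_m)\leftarrow R_1(\mathbf{y}_1)\wedge\cdots\wedge R_n(\mathbf{y}_n)$, $m\ge 0$, $n>0$, where every head variable occurs in the body (empty head: $\bot$). A disjunctive datalog (DDlog) program $\Pi$ is a finite set of such rules with a selected predicate $\mathsf{goal}$ that does not occur in rule bodies and occurs in heads only in rules $\mathsf{goal}(\mathbf{x})\leftarrow R_1(\mathbf{x}_1)\wedge\cdots\wedge R_n(\mathbf{x}_n)$. Relation symbols occurring in some rule head are IDB predicates, the others EDB predicates. $\Pi$ defines the query $q_\Pi$ over the schema of its EDB predicates: $q_\Pi(\mathfrak{D})$ is the set of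 $\mathbf{a}\in\mathrm{adom}(\mathfrak{D})^n$ ($n$ the arity of $\mathsf{goal}$) with $\mathsf{goal}(\mathbf{a})\in\mathfrak{D}'$ for all instances $\mathfrak{D}'\supseteq\mathfrak{D}$ over the IDB and EDB predicates satisfying all rules of $\Pi$. $\Pi$ is an MDDlog program if all IDB predicates except possibly $\mathsf{goal}$ are unary. MDDlog denotes the language of all queries defined by MDDlog programs.
   Formalization: The equivalence of (ALCHIU,UCQ) with MDDlog is stated for non-empty instances only: on the empty instance a Boolean MDDlog query is always false, while e.g. the ontology {⊤ ⊑ A} with query ∃x A(x) is true, so the literal claim fails there. *)

(* Defs.v *)
(* MathComp, with finmap for finite sets of facts and of symbols. *)
From Stdlib Require List.
From mathcomp Require Import all_boot finmap.

Set Implicit Arguments.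
Unset Strict Implicit.
Unset Printing Implicit Defensive.

Local Open Scope fset_scope.

(* A relation symbol is a pair (name, arity). *)
Definition symbol : Type := (nat * nat)%type.
Definition arity (R : symbol) : nat := R.2.
Definition concept_name (A : nat) : symbol := (A, 1).
Definition role_name (R : nat) : symbol := (R, 2).

Definition schema : Type := {fset symbol}.
Definition binary_schema (S : schema) : Prop :=
  forall R, R \in S -> arity R = 1 \/ arity R = 2.

Definition const : Type := nat.
Definition fact : Type := (symbol * seq const)%type.
Definition instance : Type := {fset fact}.
Definition instance_over (S : schema) (D : instance) : Prop :=
  forall f, f \in D -> f.1 \in S /\ size f.2 = arity f.1.
Definition adom (D : instance) : {fset const} :=
  \bigcup_(f <- D) [fset c | c in f.2].

(* Only the values at instances over the schema at hand are meaningful; see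
   [equivalent_on]. *)
Definition query (n : nat) : Type := instance -> n.-tuple const -> Prop.

(* [Q S n q]: the n-ary query q over the schema S belongs to Q. *)
Definition query_language : Type := forall (S : schema) (n : nat), query n -> Prop.

(* Two queries over S are equivalent when they agree on all S-instances, which
   is the case K = predT.  Another K only compares them on S-instances in K. *)
Definition equivalent_on (K : pred instance) (S : schema) (n : nat)
    (q1 q2 : query n) : Prop :=
  forall D, K D -> instance_over S D -> forall a, q1 D a <-> q2 D a.

(* Expressive power is compared over binary schemas only. *)
Definition at_least_as_expressive_on (K : pred instance)
    (Q2 Q1 : query_language) : Prop :=
  forall (S : schema) (n : nat) (q1 : query n), binary_schema S -> Q1 S n q1 ->
    exists q2 : query n, Q2 S n q2 /\ equivalent_on K S q1 q2.

Definition at_least_as_expressive (Q2 Q1 : query_language) : Prop :=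
  at_least_as_expressive_on predT Q2 Q1.
Definition same_expressive_power (Q1 Q2 : query_language) : Prop :=
  at_least_as_expressive Q2 Q1 /\ at_least_as_expressive Q1 Q2.
Definition strictly_more_expressive (Q2 Q1 : query_language) : Prop :=
  at_least_as_expressive Q2 Q1 /\ ~ at_least_as_expressive Q1 Q2.

(* Same expressive power up to the value of queries at the empty instance.  On
   the empty instance the only tuple to be answered is the empty one, so this
   differs from [same_expressive_power] for Boolean queries only.  It is needed
   because every rule body of a disjunctive datalog program is non-empty, so
   that a Boolean program is never true in the empty instance, whereas the
   domain of a structure is non-empty, so that (for example) the ontology
   {Top [= A} with the query "exists x, A(x)" is. *)
Definition same_expressive_power_nonempty (Q1 Q2 : query_language) : Prop :=
  at_least_as_expressive_on [pred D | D != fset0] Q2 Q1 /\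
  at_least_as_expressive_on [pred D | D != fset0] Q1 Q2.

(* Atoms over variables in nat, shared by formulas, queries and rules. *)
Definition var : Type := nat.
Definition atom : Type := (symbol * seq var)%type.
Definition inst (h : var -> const) (t : atom) : fact := (t.1, map h t.2).
Definition atom_over (S : schema) (t : atom) : Prop :=
  t.1 \in S /\ size t.2 = arity t.1.
Definition atoms_syms (s : seq atom) : {fset symbol} := [fset t.1 | t in s].
Definition atoms_vars (s : seq atom) : seq var := flatten (map snd s).

(* A conjunctive query of arity n: the answer variables are 0, ..., n-1 and all
   other variables are existentially quantified. *)
Definition cq : Type := (seq atom * seq (var * var))%type.
Definition cq_atoms (p : cq) : seq atom := p.1.
Definition cq_eqs (p : cq) : seq (var * var) := p.2.

Definition cq_vars (p : cq) : seq var :=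
  atoms_vars (cq_atoms p) ++ map fst (cq_eqs p) ++ map snd (cq_eqs p).

Definition cq_holds (n : nat) (p : cq) (D : instance) (a : n.-tuple const) : Prop :=
  exists h : var -> const,
    [/\ forall i : 'I_n, h i = tnth a i,
        forall x, x \in cq_vars p -> h x \in adom D,
        forall t, t \in cq_atoms p -> inst h t \in D
      & forall x y, (x, y) \in cq_eqs p -> h x = h y].

(* Active-domain semantics, as for any query on instances. *)
Definition ucq_query (n : nat) (u : seq cq) : query n := fun D a =>
  (forall i, tnth a i \in adom D) /\ exists2 p, p \in u & cq_holds p D a.

Definition UCQ : query_language := fun S n q =>
  exists u : seq cq,
    (forall p, p \in u -> forall t, t \in cq_atoms p -> atom_over S t) /\
    q = ucq_query u.

Inductive fo : Type :=
  | FRel of atom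
  | FEq of var & var
  | FTrue
  | FFalse
  | FNot of fo
  | FAnd of fo & fo
  | FOr of fo & fo
  | FImp of fo & fo
  | FEx of var & fo
  | FAll of var & fo.

Fixpoint fo_sig (phi : fo) : {fset symbol} :=
  match phi with
  | FRel t => [fset t.1]
  | FEq _ _ | FTrue | FFalse => fset0
  | FNot p | FEx _ p | FAll _ p => fo_sig p
  | FAnd p q | FOr p q | FImp p q => fo_sig p `|` fo_sig q
  end.

Definition upd (e : var -> const) (x : var) (d : const) : var -> const :=
  fun y => if y == x then d else e y.

Fixpoint sat (dom : {fset const}) (D : instance) (e : var -> const) (phi : fo)
    : Prop :=
  match phi with
  | FRel t => inst e t \in D
  | FEq x y => e x = e y
  | FTrue => True
  | FFalse => False
  | FNot p => ~ sat dom D e p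
  | FAnd p q => sat dom D e p /\ sat dom D e q
  | FOr p q => sat dom D e p \/ sat dom D e q
  | FImp p q => sat dom D e p -> sat dom D e q
  | FEx x p => exists2 d, d \in dom & sat dom D (upd e x d) p
  | FAll x p => forall d, d \in dom -> sat dom D (upd e x d) p
  end.

(* The formulas of all ontology languages below are sentences, so that the
   quantification over assignments in [models] is immaterial. *)
Definition ontology_language : Type := fo -> Prop.
Definition ontology : Type := seq fo.
Definition ontology_in (L : ontology_language) (O : ontology) : Prop :=
  List.Forall L O.
Definition sig (O : ontology) : {fset symbol} :=
  foldr (fun phi X => fo_sig phi `|` X) fset0 O.
Definition models (dom : {fset const}) (D : instance) (O : ontology) : Prop :=
  List.Forall (fun phi => forall e, sat dom D e phi) O.

Definition finite_structure (S : schema) (dom : {fset const}) (D : instance)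
    : Prop :=
  [/\ dom != fset0, instance_over S D & adom D `<=` dom].

Definition certain_answers (S : schema) (O : ontology) (n : nat) (q : query n)
    : query n := fun D a =>
  (forall i, tnth a i \in adom D) /\
  forall (dom : {fset const}) (D' : instance),
    finite_structure (S `|` sig O) dom D' -> models dom D' O -> D `<=` D' ->
    q D' a.

(* The query language (L, Q) of ontology-mediated queries. *)
Definition OMQ (L : ontology_language) (Q : query_language) : query_language :=
  fun S n q' =>
    exists (O : ontology) (q : query n),
      [/\ ontology_in L O, Q (S `|` sig O) n q & q' = certain_answers S O q].

(* [Univ] is the universal role: it is not a relation symbol, and its atoms
   translate to a valid formula. *)
Inductive role : Type := RName of nat | Univ.

Inductive concept : Type :=
  | CName of nat
  | CTop
  | CBot
  | CNot of concept
  | CAnd of concept & concept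
  | COr of concept & concept
  | CEx of role & concept
  | CAll of role & concept.

Definition tr_role (R : role) (x y : var) : fo :=
  match R with
  | RName r => FRel (role_name r, [:: x; y])
  | Univ => FTrue
  end.

(* The only free variable of [tr x C] is x, so x.+1 is fresh. *)
Fixpoint tr (x : var) (C : concept) : fo :=
  match C with
  | CName A => FRel (concept_name A, [:: x])
  | CTop => FTrue
  | CBot => FFalse
  | CNot C => FNot (tr x C)
  | CAnd C D => FAnd (tr x C) (tr x D)
  | COr C D => FOr (tr x C) (tr x D)
  | CEx R C => FEx x.+1 (FAnd (tr_role R x x.+1) (tr x.+1 C))
  | CAll R C => FAll x.+1 (FImp (tr_role R x x.+1) (tr x.+1 C))
  end.

Fixpoint univ_free (C : concept) : bool :=
  match C with
  | CName _ | CTop | CBot => true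
  | CNot C => univ_free C
  | CAnd C D | COr C D => univ_free C && univ_free D
  | CEx R C | CAll R C => (if R is RName _ then true else false) && univ_free C
  end.

Definition concept_inclusion (C D : concept) : fo := FAll 0 (FImp (tr 0 C) (tr 0 D)).
Definition role_atom (R : nat) (x y : var) : fo := FRel (role_name R, [:: x; y]).
Definition role_inclusion (R T : nat) : fo :=
  FAll 0 (FAll 1 (FImp (role_atom R 0 1) (role_atom T 0 1))).
Definition inverse_roles (R T : nat) : fo :=
  FAll 0 (FAll 1 (FAnd (FImp (role_atom R 0 1) (role_atom T 1 0))
                       (FImp (role_atom T 1 0) (role_atom R 0 1)))).
Definition functional_role (R : nat) : fo :=
  FAll 0 (FAll 1 (FAll 2
    (FImp (FAnd (role_atom R 0 1) (role_atom R 0 2)) (FEq 1 2)))).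
Definition transitive_role (R : nat) : fo :=
  FAll 0 (FAll 1 (FAll 2
    (FImp (FAnd (role_atom R 0 1) (role_atom R 1 2)) (role_atom R 0 2)))).

Definition ALC : ontology_language := fun phi =>
  exists C D, [/\ univ_free C, univ_free D & phi = concept_inclusion C D].

Definition ALCHIU : ontology_language := fun phi =>
  [\/ exists C D, phi = concept_inclusion C D,
      exists R T, phi = role_inclusion R T
    | exists R T, phi = inverse_roles R T].

(* The description logic S, that is, ALC with transitive roles. *)
Definition DL_S : ontology_language := fun phi =>
  ALC phi \/ exists R, phi = transitive_role R.

Definition ALCF : ontology_language := fun phi =>
  ALC phi \/ exists R, phi = functional_role R.

(* A disjunctive datalog rule (head, body); the empty head stands for falsum. *)
Definition rule : Type := (seq atom * seq atom)%type.
Definition rule_head (r : rule) : seq atom := r.1.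
Definition rule_body (r : rule) : seq atom := r.2.
Definition program : Type := seq rule.

Definition satisfies_rule (D : instance) (r : rule) : Prop :=
  forall h : var -> const,
    (forall t, t \in rule_body r -> inst h t \in D) ->
    exists2 t, t \in rule_head r & inst h t \in D.

Definition wf_rule (goal : symbol) (r : rule) : Prop :=
  [/\ rule_body r != [::],
      {subset atoms_vars (rule_head r) <= atoms_vars (rule_body r)},
      forall t, t \in rule_head r ++ rule_body r -> size t.2 = arity t.1,
      goal \notin atoms_syms (rule_body r)
    & goal \in atoms_syms (rule_head r) -> size (rule_head r) = 1].

Definition ddlog_program (goal : symbol) (P : program) : Prop :=
  forall r, r \in P -> wf_rule goal r.

Definition idb (P : program) : {fset symbol} :=
  atoms_syms (flatten (map rule_head P)).
Definition edb (P : program) : {fset symbol} :=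
  atoms_syms (flatten (map rule_body P)) `\` idb P.

Definition ddlog_query (goal : symbol) (P : program) (n : nat) : query n :=
  fun D a =>
    (forall i, tnth a i \in adom D) /\
    forall D' : instance, instance_over (idb P `|` edb P) D' -> D `<=` D' ->
      (forall r, r \in P -> satisfies_rule D' r) -> (goal, val a) \in D'.

Definition monadic (goal : symbol) (P : program) : Prop :=
  forall R, R \in idb P -> R != goal -> arity R = 1.

Definition MDDlog : query_language := fun S n q =>
  exists (goal : symbol) (P : program),
    [/\ ddlog_program goal P, monadic goal P, arity goal = n, edb P = S
      & q = @ddlog_query goal P n].

(* Main.v *)
(* From MDDlog to ALC, a unary IDB predicate A is guessed by [Top <= A or bar A],
   and the UCQ detects a violated rule.

   From ALCHIU to MDDlog, colour every element of the data D with its type in a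
   countermodel: the subconcepts of the ontology and the small unary CQs that
   hold there.  Conversely, if a colouring of D is realized, around every small
   set of elements, by some finite countermodel, then attaching to each element
   d of D a finite pointed model of the colour of d gives a finite countermodel
   for D: concepts and small CQs are evaluated in it as in the local
   countermodels.  Hence certain answers are captured by the MDDlog program that
   guesses a colouring and contains all goal rules of bounded size that are
   sound for types of models.

   Separations: MDDlog queries are preserved under homomorphisms, but "r is not
   functional" is not; and a colouring of a long directed path can be cut and
   pasted into one of a directed cycle, whereas transitivity of r with the query
   r(x,x) tells cycles from paths. *)
Require Import Defs.
From Stdlib Require List.
From mathcomp Require Import all_boot finmap boolp.

Set Implicit Arguments.
Unset Strict Implicit.
Unset Printing Implicit Defensive.

Local Open Scope fset_scope.
Local Open Scope nat_scope.

(** * Active domains, finite sets of facts, and the symbols of programs and ontologies *)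

Lemma adomP (D : instance) c :
  reflect (exists2 f, f \in D & c \in f.2) (c \in adom D).
Proof.
apply: (iffP (bigfcupP _ _ _ _)) => [[f /andP[fD _]]|[f fD cf]].
  by case/imfsetP => c' /= c'f ->; exists f.
by exists f; rewrite ?fD //; apply/imfsetP; exists c.
Qed.

Lemma mem_adom (D : instance) f c : f \in D -> c \in f.2 -> c \in adom D.
Proof. by move=> fD cf; apply/adomP; exists f. Qed.

Lemma adomS (D D' : instance) : D `<=` D' -> adom D `<=` adom D'.
Proof.
by move/fsubsetP => s; apply/fsubsetP => c /adomP[f /s fD cf]; apply: mem_adom cf.
Qed.

Lemma adom0 : adom fset0 = fset0.
Proof. by apply/fsetP => c; rewrite inE; apply/adomP => -[f]; rewrite inE. Qed.

Fixpoint words (X : seq const) m : seq (seq const) :=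
  if m is m'.+1 then [seq x :: s | x <- X, s <- words X m'] else [:: [::]].

Lemma mem_words X m s : (s \in words X m) = (size s == m) && all [in X] s.
Proof.
elim: m s => [|m IH] [|x s] //=; first by apply/negP => /allpairsP[[]] ? ? [].
rewrite eqSS andbCA -IH; apply/allpairsP/andP => [[[y t] /= [yX tw [-> ->]]] //|].
by case=> xX sw; exists (x, s).
Qed.

Definition facts_over (S : schema) (X : seq const) : instance :=
  seq_fset tt (flatten [seq [seq (R, s) | s <- words X (arity R)] | R <- S]).

Lemma facts_overP S X (f : fact) :
  reflect [/\ f.1 \in S, size f.2 = arity f.1 & {subset f.2 <= X}]
          (f \in facts_over S X).
Proof.
rewrite seq_fsetE; apply: (iffP flatten_mapP) => [[R RS /mapP[s sw ->]]|].
  by move: sw; rewrite mem_words => /andP[/eqP ? /allP].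
case: f => R s /= [RS sz sX]; exists R => //; apply/mapP; exists s => //.
by rewrite mem_words sz eqxx; apply/allP.
Qed.

Lemma inst_comp g h t : inst g (inst h t) = inst (g \o h) t.
Proof. by rewrite /inst /= -map_comp. Qed.

Lemma eq_in_inst g h (t : atom) : {in t.2, g =1 h} -> inst g t = inst h t.
Proof. by rewrite /inst => /eq_in_map ->. Qed.

Lemma mem_atoms_vars (s : seq atom) (t : atom) v :
  t \in s -> v \in t.2 -> v \in atoms_vars s.
Proof. by move=> ts vt; apply/flatten_mapP; exists t. Qed.

Lemma mem_atoms_syms (s : seq atom) R :
  reflect (exists2 t, t \in s & R = t.1) (R \in atoms_syms s).
Proof. exact: imfsetP. Qed.

Lemma mem_idb (P : program) R :
  reflect (exists2 r, r \in P & exists2 t, t \in rule_head r & R = t.1)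
          (R \in idb P).
Proof.
apply: (iffP (mem_atoms_syms _ _)) => [[t /flatten_mapP[r rP tr] ->]|].
  by exists r => //; exists t.
by move=> [r rP [t tr ->]]; exists t => //; apply/flatten_mapP; exists r.
Qed.

Lemma mem_body_edb (P : program) R :
  reflect (exists2 r, r \in P & exists2 t, t \in rule_body r & R = t.1)
          (R \in atoms_syms (flatten (map rule_body P))).
Proof.
apply: (iffP (mem_atoms_syms _ _)) => [[t /flatten_mapP[r rP tr] ->]|].
  by exists r => //; exists t.
by move=> [r rP [t tr ->]]; exists t => //; apply/flatten_mapP; exists r.
Qed.

Lemma edb_idb_body (P : program) r t :
  r \in P -> t \in rule_body r -> t.1 \in idb P `|` edb P.
Proof.
move=> rP tr; rewrite in_fsetU in_fsetD; case: (t.1 \in idb P) => //=.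
by apply/mem_body_edb; exists r => //; exists t.
Qed.

Lemma goal_notin_edb goal P : ddlog_program goal P -> goal \notin edb P.
Proof.
move=> wf; rewrite in_fsetD negb_and; apply/orP; right.
apply/negP => /mem_body_edb[r rP [t tr e]].
by case: (wf _ rP) => _ _ _ /negP h _; apply: h; apply/mem_atoms_syms; exists t.
Qed.

Lemma sig_map (I : eqType) (F : I -> fo) (s : seq I) R :
  reflect (exists2 i, i \in s & R \in fo_sig (F i)) (R \in sig (map F s)).
Proof.
elim: s => [|i s IH] /=; first by rewrite inE; constructor => -[].
rewrite in_fsetU; apply: (iffP orP) => [[Ri|/IH[j js Rj]]|[j]].
- by exists i; rewrite ?mem_head.
- by exists j; rewrite // inE js orbT.
rewrite inE => /orP[/eqP -> ?|js Rj]; [by left|right].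
by apply/IH; exists j.
Qed.

Lemma Forall_map (I : eqType) T (Q : T -> Prop) (F : I -> T) (s : seq I) :
  List.Forall Q (map F s) <-> {in s, forall i, Q (F i)}.
Proof.
elim: s => [|i s IH] /=; first by split=> // _; constructor.
split=> [H|H].
  have [Qi /IH Qs] : Q (F i) /\ List.Forall Q (map F s) by inversion H.
  by move=> j; rewrite inE => /orP[/eqP ->|/Qs].
constructor; first exact: H (mem_head _ _).
by apply/IH => j js; apply: H; rewrite inE js orbT.
Qed.

(** Bounding names alone makes every symbol named [b] or above new, whatever its arity. *)
Lemma fresh_name (S : schema) : exists b, forall R, R \in S -> R.1 < b.
Proof.
exists (\max_(R <- S) R.1).+1 => R RS; rewrite ltnS.
by apply: (@leq_bigmax_seq _ (enum_fset S) xpredT (fun R : symbol => R.1)).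
Qed.

(** * MDDlog programs as ALC queries *)

Section MDDlogToALC.
Variables (S : schema) (goal : symbol) (P : program) (n : nat).
Hypotheses (wf : ddlog_program goal P) (mon : monadic goal P).
Hypotheses (ar_goal : arity goal = n) (edbS : edb P = S).
Variable b : nat.
Hypothesis b_fresh : forall R, R \in S `|` idb P -> R.1 < b.

Definition bar (R : symbol) : symbol := concept_name (b + R.1).
Definition colours : {fset symbol} := idb P `\ goal.
(** [A] and [bar A] may overlap: this only creates more matches of the violations, which are
    positive, while countermodels have no match. *)
Definition cover_ontology : ontology :=
  [seq concept_inclusion CTop (COr (CName A.1) (CName (bar A).1)) | A <- colours].

Definition shift (s : seq var) := map (addn n) s.
(* The rule is violated when bars are complements and goal holds everywhere but
   at the answer tuple.  Rule variables are shifted by n, past the answer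
   variables. *)
Definition violation (r : rule) : cq :=
  ([seq (t.1, shift t.2) | t <- rule_body r]
     ++ [seq (bar t.1, shift t.2) | t <- rule_head r & t.1 != goal],
   flatten [seq [seq (i, n + nth 0 t.2 i) | i <- iota 0 n]
           | t <- rule_head r & t.1 == goal]).
Definition violations : seq cq := map violation P.

Lemma colour_arity A : A \in colours -> A = concept_name A.1.
Proof.
rewrite in_fsetD1 => /andP[Ag AP]; move: (mon AP Ag).
by case: A {Ag AP} => a m; rewrite /arity /= => ->.
Qed.

Lemma sig_coverP R :
  reflect (exists2 A, A \in colours & R = A \/ R = bar A) (R \in sig cover_ontology).
Proof.
apply: (iffP (sig_map _ _ _)) => -[A AI] /=.
  rewrite !inE /= -(colour_arity AI) => /orP[] /eqP ->; exists A; auto.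
by move=> H; exists A; rewrite //= !inE /= -(colour_arity AI); case: H => ->;
  rewrite eqxx ?orbT.
Qed.

Lemma bar_fresh A R : R \in S `|` idb P -> R != bar A.
Proof.
move=> /b_fresh Rb; apply/eqP => E; move: Rb; rewrite E /= ltnNge.
by rewrite leq_addr.
Qed.

Lemma ddlog_symbol_cases R : R \in idb P `|` edb P -> R != goal ->
  R \in S `|` sig cover_ontology.
Proof.
rewrite edbS !in_fsetU => /orP[RP Rg|-> //]; apply/orP; right.
by apply/sig_coverP; exists R; rewrite ?in_fsetD1 ?Rg; auto.
Qed.

Lemma models_cover dom (M : instance) :
  models dom M cover_ontology <->
  forall A d, A \in colours -> d \in dom -> (A, [:: d]) \in M \/ (bar A, [:: d]) \in M.
Proof.
split=> [/Forall_map H A d AI dd|H].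
  have := H _ AI (fun=> 0) d dd I; rewrite /= /inst /= -(colour_arity AI).
  by rewrite /upd eqxx.
apply/Forall_map => A AI e d dd _ /=.
by rewrite /inst /= -(colour_arity AI) /upd eqxx; apply: H.
Qed.

Lemma violations_over p t : p \in violations -> t \in cq_atoms p ->
  atom_over (S `|` sig cover_ontology) t.
Proof.
case/mapP => r rP ->; have [_ _ ar gb _] := wf rP.
rewrite mem_cat => /orP[|] /mapP[s].
  move=> sr ->; split; last by rewrite size_map ar // mem_cat sr orbT.
  apply: ddlog_symbol_cases => /=; first exact: edb_idb_body sr.
  by apply: contraNneq gb => <-; apply/mem_atoms_syms; exists s.
rewrite mem_filter => /andP[sg sr] ->.
have sI : s.1 \in colours.
  by rewrite in_fsetD1 sg; apply/mem_idb; exists r => //; exists s.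
split; last first.
  by rewrite size_map ar ?mem_cat ?sr // (colour_arity sI).
rewrite in_fsetU; apply/orP; right; apply/sig_coverP.
by exists s.1; auto.
Qed.

(** If [goal] heads no rule, it lies outside the schema of the program, and no goal facts may be
    added; hence the condition on [idb P]. *)
Definition counter_tuples (X : {fset const}) (a : n.-tuple const) : instance :=
  [fset f in facts_over [fset goal] X | (f.2 != val a) && (goal \in idb P)].

(** Let no violation match at [a] in a model [M]. Restrict [M] to the program symbols other than
    [goal] and add all goal facts except the one for [a]. Every rule then holds: where one failed,
    the covering axioms would put the bars of its head atoms into [M], and its violation would
    match. So the program does not derive [a]. *)
Lemma ddlog_to_cover (D : instance) (a : n.-tuple const) : instance_over S D ->
  @ddlog_query goal P n D a ->
  certain_answers S cover_ontology (ucq_query violations) D a.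
Proof.
move=> DS [aD H]; split=> // dom M [dom0 MS /fsubsetP Mdom] /models_cover MO DM.
have aM i : tnth a i \in adom M by apply: (fsubsetP (adomS DM)).
split=> //.
have [//|nq] := EM (exists2 p, p \in violations & cq_holds p M a).
have gS : goal \notin S by rewrite -edbS goal_notin_edb.
pose D' := [fset f in M | (f.1 \in idb P `|` edb P) && (f.1 != goal)]
             `|` counter_tuples (adom M) a.
have D'E f : (f \in D') =
    [&& f \in M, f.1 \in idb P `|` edb P & f.1 != goal]
    || [&& f \in facts_over [fset goal] (adom M), f.2 != val a & goal \in idb P].
  by rewrite !inE.
have goalD' xs : (goal, xs) \in D' ->
    xs != a.
  by rewrite D'E /= eqxx !andbF /= => /and3P[].
suff /goalD' : (goal, val a) \in D' by rewrite eqxx.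
apply: H => [f| |r rP h hb].
- rewrite D'E => /orP[/and3P[fM f1 _]|]; first by split=> //; case: (MS _ fM).
  move=> /and3P[/facts_overP[/fset1P -> sz _] _ gP].
  by rewrite sz in_fsetU gP.
- apply/fsubsetP => f fD; have [fS _] := DS _ fD.
  rewrite D'E (fsubsetP DM) // in_fsetU edbS fS orbT /=.
  by apply/orP; left; apply: contraNneq gS => <-.
have [_ hv ar gb _] := wf rP.
apply: contrapT => nh; apply: nq; exists (violation r); first exact: map_f.
have hbM t : t \in rule_body r -> inst h t \in M.
  move=> tr; have := hb t tr; rewrite D'E => /orP[/and3P[]//|].
  move=> /and3P[/facts_overP[/fset1P /= tg _ _] _ _].
  by case/negP: gb; apply/mem_atoms_syms; exists t.
have hadom v : v \in atoms_vars (rule_body r) -> h v \in adom M.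
  by move=> /flatten_mapP[t tr vt]; apply: mem_adom (hbM _ tr) _; apply: map_f.
(* Answer variables are below [n]; the rule variables were shifted to [n] and above. *)
pose g v := if v < n then nth 0 a v else h (v - n).
have gi i : i < n -> g i = nth 0 a i by rewrite /g => ->.
have gn v : g (n + v) = h v by rewrite /g ltnNge leq_addr addKn.
have inst_shift R s : inst g (R, shift s) = inst h (R, s).
  rewrite /inst /= /shift -map_comp; congr pair; apply: eq_map => v /=.
  exact: gn.
have hadom' v : v \in atoms_vars (rule_head r) -> h v \in adom M.
  by move=> /hv /hadom.
have nthM i : i < n -> nth 0 a i \in adom M.
  by move=> lt; have := aM (Ordinal lt); rewrite (tnth_nth 0).
have szg t : t \in rule_head r -> t.1 = goal -> size t.2 = n.
  by move=> tr tg; rewrite ar ?mem_cat ?tr // tg ar_goal.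
exists g; split=> [i|v|t|x y].
- by rewrite gi // (tnth_nth 0).
- rewrite !mem_cat => /or3P[|/mapP[[x y] xy ->]|/mapP[[x y] xy ->]].
  + rewrite /atoms_vars /= map_cat flatten_cat mem_cat.
    case/orP=> /flatten_mapP[s' /mapP[s sr ->] /= /mapP[w ws ->]]; rewrite gn.
      exact/hadom/(mem_atoms_vars sr).
    apply/hadom'/(mem_atoms_vars (t := s)) => //.
    by move: sr; rewrite mem_filter => /andP[].
  + case/flatten_mapP: xy => t _ /mapP[i]; rewrite mem_iota add0n => lt [-> _].
    by rewrite gi // nthM.
  + case/flatten_mapP: xy => t; rewrite mem_filter => /andP[/eqP tg tr].
    case/mapP => i; rewrite mem_iota add0n => lt [_ ->]; rewrite gn hadom' //.
    by apply: (mem_atoms_vars tr); apply: mem_nth; rewrite szg.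
- rewrite mem_cat => /orP[] /mapP[s sr ->]; first by rewrite inst_shift; exact: hbM sr.
  move: sr; rewrite inst_shift mem_filter => /andP[sg sr].
  have sP : s.1 \in idb P by apply/mem_idb; exists r => //; exists s.
  have sI : s.1 \in colours by rewrite in_fsetD1 sg.
  have: size s.2 = 1 by rewrite ar ?mem_cat ?sr // (colour_arity sI).
  case E: s.2 => [|x [|]] // _.
  have xM : h x \in dom.
    by apply/Mdom/hadom'/(mem_atoms_vars sr); rewrite E mem_head.
  case: (MO _ _ sI xM) => // sM; case: nh; exists s => //.
  by rewrite D'E /inst E /= sM in_fsetU sP sg.
- case/flatten_mapP => t; rewrite mem_filter => /andP[/eqP tg tr].
  case/mapP => i; rewrite mem_iota add0n => lt [-> ->]; rewrite gn gi //.
  (* Goal facts at other tuples are among the [counter_tuples], so a failing goal head can only be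
     the one at [a]. *)
  have [e|ne] := eqVneq (map h t.2) (val a).
    by rewrite -e (nth_map 0) // szg.
  case: nh; exists t => //; rewrite D'E; apply/orP; right.
  rewrite /= ne; apply/andP; split; last first.
    by apply/mem_idb; exists r => //; exists t.
  apply/facts_overP; split=> /=; first by rewrite tg inE.
    by rewrite size_map ar // mem_cat tr.
  by move=> _ /mapP[v vt ->]; apply/hadom'/(mem_atoms_vars tr).
Qed.

(** From a model [D'] of the program that lacks the goal fact for [a], drop all goal facts and add
    [bar A] exactly where [A] is missing. A match of a violation instantiates a rule whose body
    holds in [D']. The head atom it yields is either the goal fact for [a], by the equalities, or a
    colour whose bar was added; both are impossible. *)
Lemma cover_to_ddlog (D : instance) (a : n.-tuple const) : instance_over S D ->
  certain_answers S cover_ontology (ucq_query violations) D a ->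
  @ddlog_query goal P n D a.
Proof.
move=> DS [aD H]; split=> // D' D'S DD' HP.
apply: contrapT => /negP ga.
(* The element [0] keeps the domain non-empty when [D'] is empty. *)
pose dom := 0 |` adom D'.
pose M1 := [fset f in D' | f.1 \in S `|` colours].
have M1E f : (f \in M1) = (f \in D') && (f.1 \in S `|` colours) by rewrite !inE.
pose M2 := [fset (bar f.1, f.2) | f in facts_over colours dom `\` D'] : instance.
have inM2 f : f \in M2 ->
    exists A xs, [/\ f = (bar A, xs), A \in colours, size xs = 1,
                     {subset xs <= dom} & (A, xs) \notin D'].
  case/imfsetP => -[A xs] /=; rewrite inE => /andP[nD /facts_overP[/= AI sz ss]] ->.
  by exists A, xs; split=> //; rewrite sz (colour_arity AI).
have [|||_ [p /mapP[r rP ->] [h [ha _ hat heq]]]] := H dom (M1 `|` M2).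
- split=> [|f|].
  + by apply/fset0Pn; exists 0; rewrite !inE.
  + rewrite in_fsetU => /orP[|/inM2[A [xs [-> AI sz _ _]]]] /=; last first.
      split; last by rewrite sz.
      by rewrite in_fsetU; apply/orP; right; apply/sig_coverP; exists A; auto.
    rewrite M1E => /andP[/D'S[_ sz] /fsetUP[fS|]]; first by rewrite in_fsetU fS.
    rewrite in_fsetD1 => /andP[fg fP]; split=> //.
    by apply: ddlog_symbol_cases; rewrite // in_fsetU fP.
  + apply/fsubsetP => c /adomP[f]; rewrite in_fsetU => /orP[|/inM2].
      by rewrite M1E => /andP[fD' _] cf; rewrite in_fsetU (mem_adom fD' cf) orbT.
    by move=> [A [xs [-> _ _ ss _]]] /= /ss.
- apply/models_cover => A d AI dd.
  case AD: ((A, [:: d]) \in D'); [left|right]; rewrite in_fsetU.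
    by rewrite M1E AD in_fsetU AI orbT.
  apply/orP; right; apply/imfsetP; exists (A, [:: d]) => //=.
  rewrite !inE AD; apply/facts_overP; split=> //=; first by rewrite (colour_arity AI).
  by move=> c; rewrite inE => /eqP ->.
- apply/fsubsetP => f fD; rewrite in_fsetU; apply/orP; left.
  by rewrite M1E (fsubsetP DD') //= in_fsetU; case: (DS _ fD) => ->.
pose g v := h (n + v).
have [_ hv ar gb _] := wf rP.
have inst_shift R s : inst h (R, shift s) = inst g (R, s).
  by rewrite /inst /= /shift -map_comp.
(* Names of bars start at [b], so bars can only come from [M2]. *)
have notM1 A xs : (bar A, xs) \notin M1.
  rewrite M1E /= negb_and; apply/orP; right; apply/negP => H1.
  suff /(bar_fresh A) : bar A \in S `|` idb P by rewrite eqxx.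
  rewrite in_fsetU; case/fsetUP: H1 => [->|] //.
  by rewrite in_fsetD1 => /andP[_ ->]; rewrite orbT.
have [t tr|t tr tD'] := HP _ rP g.
  have: inst h (t.1, shift t.2) \in M1 `|` M2.
    by apply: hat; rewrite mem_cat map_f.
  rewrite inst_shift in_fsetU => /orP[|/inM2[A [xs [[tA _] _ _ _ _]]]].
    by rewrite M1E => /andP[].
  have : t.1 \in S `|` idb P.
    by have := edb_idb_body rP tr; rewrite edbS fsetUC.
  by move=> /(bar_fresh A); rewrite tA eqxx.
have [tg|tg] := eqVneq t.1 goal.
  have sz : size t.2 = n by rewrite ar ?mem_cat ?tr // tg.
  case/negP: ga; rewrite (_ : (goal, val a) = inst g t) // /inst tg; congr pair.
  apply: (@eq_from_nth _ 0); first by rewrite size_map sz size_tuple.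
  move=> i; rewrite size_tuple => lt; rewrite (nth_map 0) ?sz //.
  have := ha (Ordinal lt); rewrite (tnth_nth 0) /= => <-.
  apply: heq; apply/flatten_mapP; exists t; first by rewrite mem_filter tg eqxx.
  by apply/mapP; exists i; rewrite // mem_iota.
have tI : t.1 \in colours.
  by rewrite in_fsetD1 tg; apply/mem_idb; exists r => //; exists t.
have: inst h (bar t.1, shift t.2) \in M1 `|` M2.
  apply: hat; rewrite mem_cat; apply/orP; right.
  by apply/mapP; exists t; rewrite // mem_filter tg.
rewrite inst_shift in_fsetU (negbTE (notM1 _ _)) => /inM2[A [xs [[/addnI e <-] AI _ _]]].
have -> : A = t.1 by rewrite (colour_arity AI) (colour_arity tI) e.
by rewrite tD'.
Qed.

End MDDlogToALC.

Lemma cover_ontology_ALC goal P b : ontology_in ALC (cover_ontology goal P b).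
Proof.
by apply/Forall_map => A _; exists CTop, (COr (CName A.1) (CName (bar b A).1)).
Qed.

Lemma ALC_expresses_MDDlog : at_least_as_expressive (OMQ ALC UCQ) MDDlog.
Proof.
move=> S n _ _ [goal [P [wf mon ar edbS ->]]].
have [b b_fresh] := fresh_name (S `|` idb P).
exists (certain_answers S (cover_ontology goal P b) (ucq_query (violations goal P n b))).
split.
  do 2!eexists; split; [exact: cover_ontology_ALC|exists (violations goal P n b)|by []].
  by split=> // p pv t; apply: (violations_over wf mon edbS pv).
move=> D _ DS a; split.
  exact: ddlog_to_cover.
exact: (cover_to_ddlog wf mon ar edbS b_fresh).
Qed.

(** * Local-to-global queries in MDDlog *)

Section LocalToGlobal.
Variables (S : schema) (n L K : nat).
Variables (good : {fset const} -> instance -> Prop) (Q : query n).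
Variable typ : {fset const} -> instance -> const -> bitseq.
Hypotheses (binS : binary_schema S) (S0 : S != fset0).
Hypothesis size_typ : forall dom M d, size (typ dom M d) = L.
Hypothesis good_adom : forall dom M, good dom M -> adom M `<=` dom.

(** A homomorphism from the part of [D] on [Y] into a structure refuting [Q], where [c] prescribes
    types. It need not be injective. *)
Definition locally_realizable (D : instance) (a : n.-tuple const)
    (c : const -> bitseq) (Y : seq const) : Prop :=
  exists dom M (h : const -> const),
    [/\ good dom M,
        {in Y, forall d, h d \in dom /\ typ dom M (h d) = c d},
        forall f, f \in D -> {subset f.2 <= Y} -> inst h f \in M
      & ~ Q M (map_tuple h a)].

(** This isolates what has to be shown about an ontology; gluing provides it for ALCHIU. The set [Y]
    contains [a] because the image of [a] must refute [Q]. *)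
Definition local_to_global : Prop :=
  forall D (a : n.-tuple const) c, D != fset0 -> instance_over S D ->
    (forall i, tnth a i \in adom D) ->
    (forall Y, Y != [::] -> {subset Y <= adom D} -> {subset a <= Y} ->
       size Y <= K -> locally_realizable D a c Y) ->
    exists dom M, [/\ good dom M, D `<=` M & ~ Q M a].

Variable b : nat.
Hypothesis b_fresh : forall R, R \in S -> R.1 < b.

Definition goal_sym : symbol := (b, n).
(** The successor keeps colours apart from [goal_sym], which is unary as well when [n] is 1. *)
Definition col (tau : bitseq) : symbol := concept_name (b + (choice.pickle tau).+1).
Definition bits : seq bitseq := [seq tval t | t <- enum {: L.-tuple bool}].
Definition cols : {fset symbol} := [fset col tau | tau in bits].

(** Colour atoms are read as statements about types, and [goal] as [Q]. *)
Definition sound_rule (x : seq var) (B : {fset atom}) : Prop :=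
  forall dom M h (a : n.-tuple const), good dom M ->
    (forall t, t \in B -> t.1 \in S -> inst h t \in M) ->
    (forall tau v, (col tau, [:: v]) \in B ->
       h v \in dom /\ typ dom M (h v) = tau) ->
    val a = map h x -> Q M a.

(** Head variables must occur in the body, so an element is reached through each position of each
    fact in which it may occur. *)
Definition guess_rules : program :=
  flatten [seq [seq ([seq (col tau, [:: i]) | tau <- bits],
                     [:: (R, iota 0 (arity R))]) | i <- iota 0 (arity R)] | R <- S].

(* Soundness of a rule is semantic, so that the program derives certain answers
   only; [local_to_global] yields that it derives them all. *)
Definition goal_rule (xB : seq var * {fset atom}) : rule :=
  ([:: (goal_sym, xB.1)], enum_fset xB.2).
Definition goal_rules : program :=
  [seq goal_rule xB
     | xB : (seq var * {fset atom}) <- allpairs pair (words (iota 0 K) n)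
                           (fpowerset (facts_over (S `|` cols) (iota 0 K)))
     & [&& xB.2 != fset0, all [in atoms_vars xB.2] xB.1 & `[<sound_rule xB.1 xB.2>]]].

Definition local_program : program := guess_rules ++ goal_rules.

Lemma mem_bits tau : (tau \in bits) = (size tau == L).
Proof.
apply/mapP/eqP => [[t _ ->]|sz]; first by rewrite size_tuple.
by exists (tcast sz (in_tuple tau)); rewrite ?mem_enum // val_tcast.
Qed.

Lemma colP R : reflect (exists2 tau, size tau = L & R = col tau) (R \in cols).
Proof.
apply: (iffP (imfsetP _ _ _ _)) => -[tau]; first by rewrite /= mem_bits => /eqP; exists tau.
by exists tau; rewrite //= mem_bits; apply/eqP.
Qed.

Lemma colNS tau : col tau \notin S.
Proof. by apply/negP => /b_fresh; rewrite /= ltnNge leq_addr. Qed.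

Lemma goal_symNS : goal_sym \notin S.
Proof. by apply/negP => /b_fresh; rewrite /= ltnn. Qed.

Lemma col_goal tau : col tau != goal_sym.
Proof. by apply/eqP => -[] /eqP; rewrite -[X in _ == X]addn0 eqn_add2l. Qed.

Lemma guess_rulesP r :
  reflect (exists R i, [/\ R \in S, i < arity R &
             r = ([seq (col tau, [:: i]) | tau <- bits], [:: (R, iota 0 (arity R))])])
          (r \in guess_rules).
Proof.
apply: (iffP flatten_mapP) => [[R RS /mapP[i]]|[R [i [RS lt ->]]]].
  by rewrite mem_iota => lt ->; exists R, i.
by exists R => //; apply/mapP; exists i; rewrite // mem_iota.
Qed.

Lemma goal_rulesP r :
  reflect (exists x (B : {fset atom}),
             [/\ r = ([:: (goal_sym, x)], enum_fset B), B != fset0,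
                 size x = n, {subset x <= iota 0 K} &
                 [/\ B `<=` facts_over (S `|` cols) (iota 0 K),
                     {subset x <= atoms_vars B} & sound_rule x B]])
          (r \in goal_rules).
Proof.
apply: (iffP (@mapP (seq var * {fset atom})%type rule _ _ _)) =>
  [[[x B]]|[x [B [-> B0 sz xK [BK xB sd]]]]].
  rewrite mem_filter => /andP[/and3P[/= B0 /allP xB /asboolP sd]].
  case/allpairsP => -[x' B'] /= [xw Bp [ex eB]]; subst x' B'.
  move=> ->; exists x, B; rewrite -fpowersetE Bp; move: xw.
  by rewrite mem_words => /andP[/eqP ? /allP].
exists (x, B) => //; rewrite mem_filter /= B0 asboolT // andbT; apply/andP; split.
  exact/allP.
apply/allpairsP; exists (x, B); split=> //=; last by rewrite fpowersetE.
by rewrite mem_words sz eqxx; apply/allP.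
Qed.

Lemma exists_S : exists R, R \in S /\ 0 < arity R.
Proof.
have [R RS] := fset0Pn _ S0; exists R; split=> //.
by case: (binS RS) => ->.
Qed.

(** A colour occurring in bodies only would be an EDB predicate. As [S] is non-empty, some guess
    rule has all colours in its head. *)
Lemma cols_idb : {subset cols <= idb local_program}.
Proof.
move=> C /colP[tau sz ->]; have [R [RS Rp]] := exists_S; apply/mem_idb.
exists ([seq (col tau, [:: 0]) | tau <- bits], [:: (R, iota 0 (arity R))]).
  by rewrite mem_cat; apply/orP; left; apply/guess_rulesP; exists R, 0.
exists (col tau, [:: 0]) => //; apply/mapP; exists tau => //.
by rewrite mem_bits sz.
Qed.

Lemma idb_cols R : R \in idb local_program -> R = goal_sym \/ R \in cols.
Proof.
case/mem_idb => r; rewrite mem_cat => /orP[/guess_rulesP|/goal_rulesP].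
  case=> R' [i [_ _ ->]] [t /mapP[tau tb ->] ->]; right; apply/colP.
  by exists tau => //; apply/eqP; rewrite -mem_bits.
by case=> x [B [-> _ _ _ _]] [t]; rewrite inE => /eqP -> ->; left.
Qed.

Lemma edb_local_program : edb local_program = S.
Proof.
apply/fsetP => R; apply/fsetDP/idP => [[/mem_body_edb[r]]|RS].
  rewrite mem_cat => /orP[/guess_rulesP|/goal_rulesP].
    by case=> R' [i [R'S _ ->]] [t]; rewrite inE => /eqP -> ->.
  case=> x [B [-> _ _ _ [/fsubsetP BK _ _]]] [t /BK /facts_overP[tS _ _] ->].
  by case/fsetUP: tS => // /cols_idb ->.
split.
  apply/mem_body_edb; exists ([seq (col tau, [:: 0]) | tau <- bits], [:: (R, iota 0 (arity R))]).
    rewrite mem_cat; apply/orP; left; apply/guess_rulesP; exists R, 0.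
    by split=> //; case: (binS RS) => ->.
  by exists (R, iota 0 (arity R)); rewrite ?mem_head.
apply/negP => /idb_cols[E|/colP[tau _ E]]; move: RS; rewrite E; apply/negP.
  exact: goal_symNS.
exact: colNS.
Qed.

Lemma ddlog_local_program : ddlog_program goal_sym local_program.
Proof.
move=> r; rewrite mem_cat => /orP[/guess_rulesP|/goal_rulesP].
  case=> R [i [RS lt ->]]; split=> //=.
  - move=> v /flatten_mapP[t /mapP[tau _ ->]]; rewrite inE => /eqP ->.
    by rewrite /atoms_vars /= cats0 mem_iota.
  - move=> t; rewrite mem_cat => /orP[/mapP[tau _ ->] //|].
    by rewrite inE => /eqP -> /=; rewrite size_iota.
  - apply/negP => /mem_atoms_syms[t]; rewrite inE => /eqP -> /= E.
    by move: goal_symNS; rewrite E RS.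
  case/mem_atoms_syms => t /mapP[tau _ ->] /= /eqP.
  by rewrite eq_sym (negbTE (col_goal _)).
case=> x [B [-> B0 sz xK [/fsubsetP BK xB _]]]; split=> //=.
- by move=> v; rewrite /atoms_vars /= cats0 => /xB.
- move=> t; rewrite inE => /orP[/eqP -> //|/BK /facts_overP[] //].
apply/negP => /mem_atoms_syms[t /BK /facts_overP[tS _ _] E]; move: tS.
rewrite -E => /fsetUP[]; first exact/negP/goal_symNS.
by case/colP => tau _ /esym/eqP; rewrite (negbTE (col_goal _)).
Qed.

Lemma monadic_local_program : monadic goal_sym local_program.
Proof. by move=> R /idb_cols[->|/colP[tau _ ->]] //; rewrite eqxx. Qed.

(** Colour each element of [D] with its type in [M], and let [goal] hold at the tuples that satisfy
    [Q] in [M]. The guess rules hold by construction and the goal rules by soundness, so this is a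
    model of the program. *)
Lemma good_to_local_program (D : instance) (a : n.-tuple const) dom M :
  instance_over S D -> @ddlog_query goal_sym local_program n D a ->
  good dom M -> D `<=` M -> Q M a.
Proof.
move=> DS [aD H] gM /fsubsetP DM.
pose D' := D `|` [fset (col (typ dom M d), [:: d]) | d in adom D]
             `|` [fset f in facts_over [fset goal_sym] (adom D) |
                    (goal_sym \in idb local_program)
                    && `[< forall a' : n.-tuple const, val a' = f.2 -> Q M a' >]] : instance.
have D'P f : f \in D' <->
    [\/ f \in D, exists2 d, d \in adom D & f = (col (typ dom M d), [:: d])
      | [/\ f \in facts_over [fset goal_sym] (adom D), goal_sym \in idb local_program &
            forall a' : n.-tuple const, val a' = f.2 -> Q M a']].
  split=> [/fsetUP[/fsetUP[|/imfsetP[d]]|]|[fD|[d dD ->]|[h1 h2 h3]]].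
  - by constructor 1.
  - by constructor 2; exists d.
  - by rewrite !inE => /andP[h1 /andP[h2 /asboolP h3]]; constructor 3.
  - by apply/fsetUP; left; apply/fsetUP; left.
  - by apply/fsetUP; left; apply/fsetUP; right; apply/imfsetP; exists d.
  - by apply/fsetUP; right; rewrite !inE h1 h2 asboolT.
have D'S f : f \in D' -> f.1 \in S -> f \in D.
  move=> /D'P[|[d _ ->]|[/facts_overP[/fset1P -> _ _] _ _]] //=.
    by rewrite (negbTE (colNS _)).
  by rewrite (negbTE goal_symNS).
have D'col tau xs : (col tau, xs) \in D' ->
    exists d, [/\ d \in adom D, tau = typ dom M d & xs = [:: d]].
  move=> /D'P[/DS[/= cS _]|[d dD [/addnI[E] ->]]|[/facts_overP[/fset1P /= E _ _] _ _]].
  - by move: cS; rewrite (negbTE (colNS _)).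
  - by exists d; split=> //; apply: (pcan_inj choice.pickleK).
  - by have := col_goal tau; rewrite E eqxx.
suff /D'P[/DS[/= gS _]|[d _ [/eqP]]|[_ _ HQ]] : (goal_sym, val a) \in D'.
- by move: gS; rewrite (negbTE goal_symNS).
- by rewrite -[X in X == _]addn0 eqn_add2l.
- exact: HQ.
apply: H => [f|| r].
- move=> /D'P[fD|[d dD ->]|[/facts_overP[/fset1P E sz _] gi _]].
  + by have [fS ->] := DS _ fD; rewrite edb_local_program in_fsetU fS orbT.
  + split=> //; rewrite in_fsetU cols_idb //; apply/colP.
    by exists (typ dom M d).
  + by rewrite sz E in_fsetU gi.
- by apply/fsubsetP => f fD; apply/D'P; constructor 1.
move=> rP; have := rP; rewrite mem_cat => /orP[/guess_rulesP|/goal_rulesP].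
  case=> R [i [RS lt ->]] h hb.
  have RD : inst h (R, iota 0 (arity R)) \in D by apply: D'S => //; apply/hb/mem_head.
  exists (col (typ dom M (h i)), [:: i]).
    by apply/mapP; exists (typ dom M (h i)); rewrite // mem_bits size_typ.
  apply/D'P; constructor 2; exists (h i) => //; apply: mem_adom RD _.
  by apply: map_f; rewrite mem_iota.
case=> x [B [er _ sz xK [/fsubsetP BK xB sd]]] h hb.
rewrite er in hb *.
(* Goal facts of [D'] range over [adom D], so the body must be mapped there; colour atoms comply
   since only elements of [D] are coloured. *)
have BD t v : t \in B -> v \in t.2 -> h v \in adom D.
  move=> tB vt; have tD := hb t tB; have [tS sz' _] := facts_overP _ _ _ (BK _ tB).
  case/fsetUP: tS => [tS|/colP[tau _ E]].
    by apply: mem_adom (D'S _ tD tS) _; apply: map_f.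
  have: (col tau, map h t.2) \in D' by rewrite -E.
  case/D'col => d [dD _ e]; suff -> : h v = d by [].
  by have := map_f h vt; rewrite e inE => /eqP.
exists (goal_sym, x); first by rewrite mem_head.
apply/D'P; constructor 3; split.
- apply/facts_overP; split=> /=; first by rewrite inE.
    by rewrite size_map.
  by move=> _ /mapP[v /xB /flatten_mapP[t tB vt] ->]; apply: BD vt.
- apply/mem_idb; exists r => //; exists (goal_sym, x); rewrite // er.
  exact: mem_head.
move=> a' ea'; apply: (sd dom M h a' gM _ _ ea') => [t tB tS|tau v vB].
  by apply: DM; apply: D'S => //; apply: hb.
have /D'col[d [dD -> [->]]] := hb _ vB; split=> //.
by apply: (fsubsetP (good_adom gM)); apply: (fsubsetP (adomS _)) dD; apply/fsubsetP.
Qed.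

(** A model of the program without the goal fact for [a] yields a colouring of [D]. If it were not
    realizable on some small [Y], the coloured part of [D] on [Y] would be the body of a sound rule
    deriving that fact. So it is realizable on every small [Y], and [local_to_global] refutes [Q] at
    [a]. *)
Lemma local_program_to_good (D : instance) (a : n.-tuple const) :
  local_to_global -> D != fset0 -> instance_over S D ->
  (forall i, tnth a i \in adom D) ->
  (forall dom M, good dom M -> D `<=` M -> Q M a) ->
  @ddlog_query goal_sym local_program n D a.
Proof.
move=> lg D0 DS aD H; split=> // D' D'S /fsubsetP DD' HP.
apply: contrapT => /negP ga.
(* Each element occurs at some position of a fact, and the guess rule for this position colours
   it. *)
have [c cP] : exists c : const -> bitseq,
    forall d, d \in adom D -> size (c d) = L /\ (col (c d), [:: d]) \in D'.
  suff /choice[c cP] : forall d, exists tau : bitseq, d \in adom D ->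
      size tau = L /\ (col tau, [:: d]) \in D' by exists c.
  move=> d; case: (boolP (d \in adom D)) => [/adomP[[R xs] fD df]|_]; last by exists [::].
  have [/= RS sz] := DS _ fD.
  have lt : index d xs < arity R by rewrite -sz index_mem.
  have rP : ([seq (col tau, [:: index d xs]) | tau <- bits], [:: (R, iota 0 (arity R))])
      \in local_program.
    by rewrite mem_cat; apply/orP; left; apply/guess_rulesP; exists R, (index d xs).
  have [t|t] := HP _ rP (nth 0 xs).
    rewrite inE => /eqP ->; rewrite /inst /= -sz map_nth_iota0 // take_size.
    exact: DD'.
  case/mapP => tau; rewrite mem_bits => /eqP ts -> /=.
  by rewrite /inst /= nth_index // => cD; exists tau.
have [|dom [M [gM DM nq]]] := lg D a c D0 DS aD; last exact: nq (H _ _ gM DM).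
move=> Y Y0 YD aY YK; apply: contrapT => nl; case/negP: ga.
pose idx d := index d Y; pose g := nth 0 Y.
have gi d : d \in Y -> g (idx d) = d by move=> dY; rewrite /g nth_index.
(* The coloured part of [D] on [Y], with elements renamed to their indices in [Y], so that all
   variables are below [K]. *)
pose B := [fset inst idx f | f in [fset f in D | all [in Y] f.2]]
            `|` [fset (col (c d), [:: idx d]) | d in Y] : {fset atom}.
have BP t : t \in B <-> (exists f, [/\ f \in D, {subset f.2 <= Y} & t = inst idx f])
    \/ exists2 d, d \in Y & t = (col (c d), [:: idx d]).
  split=> [/fsetUP[]|[[f [fD fY ->]]|[d dY ->]]].
  - case/imfsetP => f /=; rewrite !inE => /andP[fD /allP fY] ->; left.
    by exists f.
  - by case/imfsetP => d /= dY ->; right; exists d.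
  - apply/fsetUP; left; apply/imfsetP; exists f => //=; rewrite !inE fD /=.
    exact/allP.
  - by apply/fsetUP; right; apply/imfsetP; exists d.
have idxK d : d \in Y -> idx d \in iota 0 K.
  by move=> dY; rewrite mem_iota add0n /= (leq_trans _ YK) // /idx index_mem.
have ea : map g (map idx a) = val a.
  by rewrite -map_comp -[RHS]map_id; apply/eq_in_map => v /aY; apply: gi.
have rP : ([:: (goal_sym, map idx a)], enum_fset B) \in local_program.
  rewrite mem_cat; apply/orP; right; apply/goal_rulesP; exists (map idx a), B; split=> //.
  - case E: Y Y0 => [|d Y'] // _; apply/fset0Pn; exists (col (c d), [:: idx d]).
    by apply/BP; right; exists d; rewrite // E mem_head.
  - by rewrite size_map size_tuple.
  - by move=> _ /mapP[v /aY /idxK vK ->].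
  split.
  - apply/fsubsetP => t /BP[[f [fD fY ->]]|[d dY ->]]; apply/facts_overP.
      have [fS sz] := DS _ fD; split; rewrite ?size_map //=.
        by rewrite in_fsetU fS.
      by move=> _ /mapP[v /fY /idxK vK ->].
    split=> //= [|v]; last by rewrite inE => /eqP ->; apply: idxK.
    rewrite in_fsetU; apply/orP; right; apply/colP; exists (c d) => //.
    by case: (cP _ (YD _ dY)).
  - move=> _ /mapP[v /aY vY ->]; apply: (@mem_atoms_vars _ (col (c v), [:: idx v])).
      by apply/BP; right; exists v.
    exact: mem_head.
  (* A counterexample to the soundness of this rule is a local realization on [Y]. *)
  move=> dom M h a' gM hS hc ea'; apply: contrapT => nq; apply: nl.
  exists dom, M, (h \o idx); split=> // [d dY|f fD fY|].
  - by apply: hc; apply/BP; right; exists d.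
  - rewrite -inst_comp; apply: hS; first by apply/BP; left; exists f.
    by case: (DS _ fD).
  suff <- : a' = map_tuple (h \o idx) a by [].
  by apply: val_inj; rewrite ea' /= map_comp.
have [t|t] := HP _ rP g.
  move=> /BP[[f [fD fY ->]]|[d dY ->]].
    rewrite inst_comp (@eq_in_inst _ id) => [|v /fY]; last exact: gi.
    by rewrite /inst map_id -surjective_pairing; apply: DD'.
  by rewrite /inst /= gi //; case: (cP _ (YD _ dY)).
by rewrite inE => /eqP ->; rewrite /inst /= ea.
Qed.

End LocalToGlobal.

(** * Gluing models of an ALCHIU ontology *)

Definition rsat (M : instance) (R : role) (d e : const) : Prop :=
  if R is RName r then (role_name r, [:: d; e]) \in M else True.

(** Semantics on elements instead of assignments; [sat_tr] relates it to the first-order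
    translation. *)
Fixpoint csat (dom : {fset const}) (M : instance) (d : const) (C : concept) : Prop :=
  match C with
  | CName A => (concept_name A, [:: d]) \in M
  | CTop => True
  | CBot => False
  | CNot C => ~ csat dom M d C
  | CAnd C D => csat dom M d C /\ csat dom M d D
  | COr C D => csat dom M d C \/ csat dom M d D
  | CEx R C => exists2 e, e \in dom & rsat M R d e /\ csat dom M e C
  | CAll R C => forall e, e \in dom -> rsat M R d e -> csat dom M e C
  end.

Lemma csat_CEx dom (M : instance) d R C : csat dom M d (CEx R C) =
  exists2 e, e \in dom & rsat M R d e /\ csat dom M e C.
Proof. by []. Qed.

Lemma csat_CAll dom (M : instance) d R C : csat dom M d (CAll R C) =
  forall e, e \in dom -> rsat M R d e -> csat dom M e C.
Proof. by []. Qed.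

Lemma sat_tr_role dom (M : instance) e R x d :
  sat dom M (upd e x.+1 d) (tr_role R x x.+1) <-> rsat M R (e x) d.
Proof. by case: R => //= r; rewrite /inst /= /upd eqxx eqn_leq ltnn andbF. Qed.

Lemma sat_tr dom (M : instance) C : forall x e,
  sat dom M e (tr x C) <-> csat dom M (e x) C.
Proof.
elim: C => //=.
- by move=> C IH x e; rewrite IH.
- by move=> C IHC D IHD x e; rewrite IHC IHD.
- by move=> C IHC D IHD x e; rewrite IHC IHD.
- move=> R C IH x e; split=> -[d dd [Rd Cd]]; exists d => //.
    split; first exact: (proj1 (sat_tr_role _ _ _ _ _ _) Rd).
    by move/IH: Cd; rewrite /upd eqxx.
  split; first exact: (proj2 (sat_tr_role _ _ _ _ _ _) Rd).
  by apply/IH; rewrite /upd eqxx.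
- move=> R C IH x e; split=> H d dd Rd.
    have /IH := H d dd (proj2 (sat_tr_role _ _ _ _ _ _) Rd).
    by rewrite /upd eqxx.
  apply/IH; rewrite {1}/upd eqxx; apply: H => //.
  exact: (proj1 (sat_tr_role _ _ _ _ _ _) Rd).
Qed.

Lemma sat_concept_inclusion dom (M : instance) C D :
  (forall e, sat dom M e (concept_inclusion C D)) <->
  forall d, d \in dom -> csat dom M d C -> csat dom M d D.
Proof.
have E e d : upd e 0 d 0 = d by rewrite /upd eqxx.
split=> [H d dd Cd|H e d dd Cd].
  have Cd' : sat dom M (upd (fun=> 0) 0 d) (tr 0 C) by apply/sat_tr; rewrite E.
  by have /sat_tr := H (fun=> 0) d dd Cd' : sat dom M _ (tr 0 D); rewrite E.
suff : sat dom M (upd e 0 d) (tr 0 D) by [].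
by apply/sat_tr; rewrite E; apply: H => //; have /sat_tr := Cd : sat dom M _ (tr 0 C); rewrite E.
Qed.

Lemma sat_role_inclusion dom (M : instance) R T :
  (forall e, sat dom M e (role_inclusion R T)) <->
  forall d e, d \in dom -> e \in dom ->
    (role_name R, [:: d; e]) \in M -> (role_name T, [:: d; e]) \in M.
Proof.
split=> [H d e dd ed|H e d dd d' dd']; first exact: (H (fun=> 0) d dd e ed).
exact: H.
Qed.

Lemma sat_inverse_roles dom (M : instance) R T :
  (forall e, sat dom M e (inverse_roles R T)) <->
  forall d e, d \in dom -> e \in dom ->
    (role_name R, [:: d; e]) \in M <-> (role_name T, [:: e; d]) \in M.
Proof.
split=> [H d e dd ed|H e d dd d' dd']; first exact: (H (fun=> 0) d dd e ed).
by have [] := H d d' dd dd'.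
Qed.

Lemma fo_sig_tr C : forall x R, R \in fo_sig (tr x C) -> arity R = 1 \/ arity R = 2.
Proof.
elim: C => //=.
- by move=> A x R; rewrite inE => /eqP ->; left.
- by move=> C IHC D IHD x R /fsetUP[/IHC|/IHD].
- by move=> C IHC D IHD x R /fsetUP[/IHC|/IHD].
- by move=> [r|] C IH x R /fsetUP[|/IH] //=; rewrite !inE // => /eqP ->; right.
- by move=> [r|] C IH x R /fsetUP[|/IH] //=; rewrite !inE // => /eqP ->; right.
Qed.

Lemma mem_sig (O : ontology) R :
  R \in sig O <-> exists2 phi, List.In phi O & R \in fo_sig phi.
Proof.
elim: O => [|phi O IH] /=; first by rewrite inE; split=> // -[].
rewrite in_fsetU; split=> [/orP[Rp|/IH[psi pO Rp]]|[psi [<- ->//|pO Rp]]].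
- by exists phi; auto.
- by exists psi; auto.
by apply/orP; right; apply/IH; exists psi.
Qed.

Lemma sig_ALCHIU_binary O R : ontology_in ALCHIU O -> R \in sig O ->
  arity R = 1 \/ arity R = 2.
Proof.
move=> /List.Forall_forall OL /mem_sig[phi /OL].
case=> [[C [D ->]]|[T [T' ->]]|[T [T' ->]]] /=.
- by move=> /fsetUP[] /fo_sig_tr.
- by rewrite !inE => /orP[] /eqP ->; right.
- by rewrite !inE => /orP[] /orP[] /eqP ->; right.
Qed.

Fixpoint subs (C : concept) : list concept :=
  C :: match C with
       | CNot C | CEx _ C | CAll _ C => subs C
       | CAnd C D | COr C D => subs C ++ subs D
       | _ => [::]
       end.

(** Asking only for some [C'] and [D'] with the same formula avoids proving the translation
    injective. *)
Lemma subs_closure (O : ontology) : ontology_in ALCHIU O ->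
  exists cs, forall C D, List.In (concept_inclusion C D) O ->
    exists C' D', [/\ concept_inclusion C D = concept_inclusion C' D',
                     List.incl (subs C') cs & List.incl (subs D') cs].
Proof.
elim: O => [|phi O IH] OL; first by exists [::].
have /IH[cs csP] : ontology_in ALCHIU O by inversion OL.
have [[C [D E]]|nCI] := EM (exists C D, phi = concept_inclusion C D); last first.
  exists cs => C D [E|/csP //]; by case: nCI; exists C, D.
exists (subs C ++ subs D ++ cs)%list => C' D' [<-|/csP[C1 [D1 [-> H1 H2]]]].
  exists C, D; split=> //; first exact: List.incl_appl.
  exact/List.incl_appr/List.incl_appl.
by exists C1, D1; split=> //; apply/List.incl_appr/List.incl_appr.
Qed.

(** * Types, and the gluing of pointed models along the data *)

Section Glue.
Variables (S : schema) (O : ontology) (n : nat) (u : seq cq).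
Hypotheses (binS : binary_schema S) (OL : ontology_in ALCHIU O).
Variable cs : list concept.
Hypothesis csP : forall C D, List.In (concept_inclusion C D) O ->
    exists C' D', [/\ concept_inclusion C D = concept_inclusion C' D',
                     List.incl (subs C') cs & List.incl (subs D') cs].

Let Sg := S `|` sig O.

Lemma Sg_binary R : R \in Sg -> arity R = 1 \/ arity R = 2.
Proof. by move=> /fsetUP[/binS|/(sig_ALCHIU_binary OL)]. Qed.

Definition good_model (dom : {fset const}) (M : instance) : Prop :=
  finite_structure Sg dom M /\ models dom M O.

Definition matches : query n := fun M a => exists2 p, p \in u & cq_holds p M a.

(** Each variable of a match lies in a fact with at most two elements, so this many elements support
    the match. *)
Definition cq_bound : nat := 2 * \max_(p <- u) size (cq_vars p).

Definition cq_test (s : {fset atom}) (dom : {fset const}) (M : instance) (d : const)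
    : Prop :=
  exists f : var -> const, f 0 = d /\ forall t, t \in s -> inst f t \in M.

(** In the CQs, variable [0] stands for the tested element, the others for up to [cq_bound] elements
    supporting a match. *)
Definition tests : list ({fset const} -> instance -> const -> Prop) :=
  (List.map (fun C dom M d => csat dom M d C) cs
   ++ List.map cq_test (fpowerset (facts_over Sg (iota 0 cq_bound.+1))))%list.

Definition type_of (dom : {fset const}) (M : instance) (d : const) : bitseq :=
  List.map (fun T : {fset const} -> instance -> const -> Prop => `[< T dom M d >]) tests.

Lemma size_type_of dom M d : size (type_of dom M d) = size tests.
Proof. exact: List.length_map. Qed.

Lemma type_of_test dom M d dom' M' d' T : List.In T tests ->
  type_of dom M d = type_of dom' M' d' -> T dom M d -> T dom' M' d'.
Proof.
by move=> TI /List.ext_in_map /(_ _ TI) E /asboolP; rewrite E => /asboolP.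
Qed.

Lemma type_of_csat dom M d dom' M' d' C : List.In C cs ->
  type_of dom M d = type_of dom' M' d' -> csat dom M d C -> csat dom' M' d' C.
Proof.
move=> CI; apply: (@type_of_test _ _ _ _ _ _ (fun dom M d => csat dom M d C)).
apply/List.in_app_iff; left.
exact: (List.in_map (fun C dom M d => csat dom M d C)).
Qed.

Lemma InP (T : eqType) (s : seq T) x : x \in s -> List.In x s.
Proof.
by elim: s => // y s IH; rewrite inE => /orP[/eqP ->|/IH]; [left|right].
Qed.

Lemma type_of_cq dom M d dom' M' d' s :
  s `<=` facts_over Sg (iota 0 cq_bound.+1) ->
  type_of dom M d = type_of dom' M' d' -> cq_test s dom M d -> cq_test s dom' M' d'.
Proof.
move=> sX; apply: type_of_test; apply/List.in_app_iff; right.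
by apply: (List.in_map cq_test); apply: InP; rewrite -fpowersetE in sX.
Qed.

Variables (D : instance) (a : n.-tuple const) (c : const -> bitseq).
Hypotheses (D0 : D != fset0) (DS : instance_over S D).
Hypothesis aD : forall i, tnth a i \in adom D.
Hypothesis loc : forall Y, Y != [::] -> {subset Y <= adom D} -> {subset a <= Y} ->
  size Y <= n + cq_bound.+2 -> locally_realizable good_model matches type_of D a c Y.

Variables (dm : const -> {fset const}) (Md : const -> instance) (rt : const -> const).
Hypothesis rootP : forall d, d \in adom D ->
  [/\ good_model (dm d) (Md d), rt d \in dm d & type_of (dm d) (Md d) (rt d) = c d].

Variable B : nat.
Hypothesis B_fresh : forall d, d \in adom D -> d < B.

(* The element m of the model attached to d; roots are identified with the
   elements of D. *)
Definition enc (d m : const) : const :=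
  if m == rt d then d else B + choice.pickle (d, m).
Definition dec (y : const) : const * const :=
  if y \in adom D then (y, rt y) else odflt (0, 0) (choice.unpickle (y - B)).

Lemma encK d m : d \in adom D -> dec (enc d m) = (d, m).
Proof.
rewrite /enc /dec => dD; case: eqP => [->|_]; first by rewrite dD.
case: ifP => [/B_fresh|_]; first by rewrite ltnNge leq_addr.
by rewrite addKn choice.pickleK.
Qed.

Lemma enc_inj d m d' m' : d \in adom D -> d' \in adom D ->
  enc d m = enc d' m' -> d = d' /\ m = m'.
Proof. by move=> dD d'D /(congr1 dec); rewrite !encK // => -[]. Qed.

Lemma enc_root d : enc d (rt d) = d. Proof. by rewrite /enc eqxx. Qed.

Lemma enc_adom d m : enc d m \in adom D -> m = rt d.
Proof. by rewrite /enc; case: eqP => // _ /B_fresh; rewrite ltnNge leq_addr. Qed.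

(* Role inclusions and inverses add facts between elements of D. *)
Definition forced (f : fact) : Prop :=
  forall dom M (h : const -> const), good_model dom M ->
    {in f.2, forall d, h d \in dom /\ type_of dom M (h d) = c d} ->
    (forall g, g \in D -> {subset g.2 <= f.2} -> inst h g \in M) ->
    inst h f \in M.

Definition glue_dom : {fset const} :=
  \bigcup_(d <- adom D) [fset enc d m | m in dm d].
(** Each [d] in [D] is the root of its own copy of [Md d]. Distinct copies are linked only by forced
    facts on [adom D], among them the facts of [D]. *)
Definition glue : instance :=
  \bigcup_(d <- adom D) [fset inst (enc d) f | f in Md d]
    `|` [fset f in facts_over Sg (adom D) | `[< forced f >]].

Lemma glue_domP y : reflect (exists d m, [/\ d \in adom D, m \in dm d & y = enc d m])
                            (y \in glue_dom).
Proof.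
apply: (iffP (bigfcupP _ _ _ _)) => [[d /andP[dD _] /imfsetP[m /= mM ->]]|].
  by exists d, m.
by move=> [d [m [dD mM ->]]]; exists d; rewrite ?dD //; apply/imfsetP; exists m.
Qed.

Lemma glueP f : f \in glue <->
  (exists d f', [/\ d \in adom D, f' \in Md d & f = inst (enc d) f'])
  \/ f \in facts_over Sg (adom D) /\ forced f.
Proof.
split=> [/fsetUP[/bigfcupP[d /andP[dD _] /imfsetP[f' /= fM ->]]|]|[[d [f' [dD fM ->]]]|[fS ff]]].
- by left; exists d, f'.
- by rewrite !inE => /andP[fS /asboolP ff]; right.
- apply/fsetUP; left; apply/bigfcupP; exists d; rewrite ?dD //.
  by apply/imfsetP; exists f'.
- by apply/fsetUP; right; rewrite !inE fS asboolT.
Qed.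

Lemma Md_good d : d \in adom D -> good_model (dm d) (Md d).
Proof. by case/rootP. Qed.

Lemma Md_dom d f m : d \in adom D -> f \in Md d -> m \in f.2 -> m \in dm d.
Proof.
move=> /Md_good[[_ _ /fsubsetP sub] _] fM mf; apply: sub; exact: mem_adom mf.
Qed.

Lemma Md_sig d f : d \in adom D -> f \in Md d -> f.1 \in Sg /\ size f.2 = arity f.1.
Proof. by move=> /Md_good[[_ MS _] _] /MS. Qed.

Lemma glue_structure : finite_structure Sg glue_dom glue.
Proof.
split=> [|f|].
- have [f fD] := fset0Pn _ D0; have [fS sz] := DS fD.
  case E: f.2 sz => [|d xs] sz.
    by case: (binS fS) sz => ->.
  have dD : d \in adom D by apply: mem_adom fD _; rewrite E mem_head.
  apply/fset0Pn; exists (enc d (rt d)); apply/glue_domP; exists d, (rt d).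
  by case: (rootP dD).
- move=> /glueP[[d [f' [dD fM ->]]]|[/facts_overP[] //]].
  by rewrite size_map; apply: Md_sig fM.
apply/fsubsetP => y /adomP[f /glueP[[d [f' [dD fM ->]]]|[/facts_overP[_ _ sub] _]]].
  move=> /mapP[m mf ->]; apply/glue_domP; exists d, m; split=> //.
  exact: Md_dom mf.
move=> /sub yD; apply/glue_domP; exists y, (rt y); rewrite enc_root.
by split=> //; case: (rootP yD).
Qed.

Lemma sub_glue : D `<=` glue.
Proof.
apply/fsubsetP => f fD; apply/glueP; right; have [fS sz] := DS fD; split.
  by apply/facts_overP; rewrite in_fsetU fS; split=> // x; apply: mem_adom.
by move=> dom M h _ _; apply.
Qed.

(** The bound leaves room for both ends of an edge, and for the roots of the copies met by a match
    together with one extra element. The answer tuple is counted separately. *)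
Lemma glue_local Y : Y != [::] -> {subset Y <= adom D} -> size Y <= cq_bound.+2 ->
  exists dom M (h : const -> const),
    [/\ good_model dom M,
        {in a ++ Y, forall d, h d \in dom /\ type_of dom M (h d) = c d},
        forall f, forced f -> {subset f.2 <= a ++ Y} -> inst h f \in M
      & ~ matches M (map_tuple h a)].
Proof.
move=> Y0 YD sY.
have sub : {subset a ++ Y <= adom D}.
  by move=> d; rewrite mem_cat => /orP[/tnthP[i ->]|/YD].
have [||||dom [M [h [gM hY hD nq]]]] := @loc (a ++ Y).
- by case: (tval a) Y0.
- exact: sub.
- by move=> x xa; rewrite mem_cat xa.
- by rewrite size_cat size_tuple leq_add2l.
exists dom, M, h; split=> // f ff fY; apply: ff gM _ _ => [d /fY /hY //|g gD gf].
by apply: hD => // x /gf /fY.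
Qed.

(** Serves to transport properties between two roots through a common model containing the forced
    facts between them; [d] and [e] may coincide. *)
Lemma glue_pair d e : d \in adom D -> e \in adom D ->
  exists dom M (h : const -> const),
    [/\ h d \in dom, h e \in dom,
        type_of dom M (h d) = type_of (dm d) (Md d) (rt d),
        type_of dom M (h e) = type_of (dm e) (Md e) (rt e)
      & forall f, forced f -> {subset f.2 <= [:: d; e]} -> inst h f \in M].
Proof.
move=> dD eD; have [//|x||dom [M [h [_ hY hf _]]]] := @glue_local [:: d; e].
- by rewrite !inE => /orP[] /eqP ->.
- by [].
have [hd td] : h d \in dom /\ type_of dom M (h d) = c d.
  by apply: hY; rewrite mem_cat mem_head orbT.
have [he te] : h e \in dom /\ type_of dom M (h e) = c e.
  by apply: hY; rewrite mem_cat !inE eqxx !orbT.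
exists dom, M, h; rewrite td te; split=> //; [by case: (rootP dD)|by case: (rootP eD)|].
by move=> f ff fde; apply: hf => // x /fde xde; rewrite mem_cat xde orbT.
Qed.

(** As [enc] is injective, an edge of a copy stays in that copy; forced facts live on [adom D],
    which contains only roots. *)
Lemma glue_edge r d m d' m' : d \in adom D -> d' \in adom D ->
  (role_name r, [:: enc d m; enc d' m']) \in glue ->
  (d = d' /\ (role_name r, [:: m; m']) \in Md d)
  \/ [/\ m = rt d, m' = rt d' & forced (role_name r, [:: d; d'])].
Proof.
move=> dD d'D /glueP[[e [[R xs] [eD fM [eR]]]]|[/facts_overP[_ _ /= sub] ff]].
  case: xs fM => [|x [|y []]] // fM [] /(enc_inj dD eD)[e1 e2] /(enc_inj d'D eD)[e3 e4].
  by left; rewrite e1 e3 eR e2 e4.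
have /enc_adom em : enc d m \in adom D by apply: sub; rewrite mem_head.
have /enc_adom em' : enc d' m' \in adom D by apply: sub; rewrite !inE eqxx orbT.
by right; move: ff; rewrite em em' !enc_root.
Qed.

Lemma glue_edge_copy r d m m' : d \in adom D -> (role_name r, [:: m; m']) \in Md d ->
  (role_name r, [:: enc d m; enc d m']) \in glue.
Proof. by move=> dD fM; apply/glueP; left; exists d, (role_name r, [:: m; m']). Qed.

(** By induction on [C]. Edges within a copy are those of its model. For a forced edge between
    roots, [glue_pair] gives a model with such an edge between elements of the same types, and the
    subconcept passes from one type to the other. The universal role is handled likewise, since what
    it expresses is the same at all elements of one model. *)
Lemma csat_glue C : List.incl (subs C) cs -> forall d m, d \in adom D -> m \in dm d ->
  csat glue_dom glue (enc d m) C <-> csat (dm d) (Md d) m C.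
Proof.
have domE d m : d \in adom D -> m \in dm d -> enc d m \in glue_dom.
  by move=> dD mM; apply/glue_domP; exists d, m.
elim: C => [A|||C IH|C IHC C' IHD|C IHC C' IHD|R C IH|R C IH];
  move=> H; have [CI I] := List.incl_cons_inv H; move=> {H} d m dD mM //.
- split=> [/glueP[[e [[R xs] [eD fM [eR]]]]|[/facts_overP[_ _ /= sub] ff]]|].
  + case: xs fM => [|x []] // fM [] /(enc_inj dD eD)[e1 e2] /=.
    by rewrite e1 eR e2.
  + have /enc_adom em : enc d m \in adom D by apply: sub; rewrite mem_head.
    rewrite em enc_root in ff *.
    have [dom [M [h [_ _ td _ hf]]]] := glue_pair dD dD.
    apply: (type_of_csat CI td) => /=; apply: (hf (_, [:: d])) => //= x.
    by rewrite !inE => ->.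
  + by move=> fM; apply/glueP; left; exists d, (concept_name A, [:: m]).
- by rewrite /= IH.
- by have /List.incl_app_inv[IC ID] := I; rewrite /= IHC // IHD.
- by have /List.incl_app_inv[IC ID] := I; rewrite /= IHC // IHD.
- have CIC : List.In C cs by apply: I; case: (C) => *; left.
  rewrite !csat_CEx; split=> [[y /glue_domP[d' [m' [d'D m'M ->]]] []]|[m' m'M [Rm Cm]]];
      last first.
    exists (enc d m'); first exact: domE.
    by split; [case: (R) Rm => //= r; apply: glue_edge_copy|apply/IH].
  rewrite (IH I _ _ d'D m'M) => Rm Cm; rewrite -csat_CEx.
  have [dom [M [h [hd hd' td td' hf]]]] := glue_pair dD d'D.
  case: R CI Rm => [r|] CI Rm.
    case: (glue_edge dD d'D Rm) => [[e Rm']|[em em' ff]].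
      by rewrite csat_CEx; exists m'; [rewrite e|split; last rewrite e].
    rewrite em; apply: (type_of_csat CI td); rewrite csat_CEx; exists (h d') => //.
    split; first exact: hf ff _.
    by apply: (type_of_csat CIC (esym td')); rewrite -em'.
  (* The truth of [CEx Univ C] does not depend on the element: the root replaces [m] here, and
     [h d'] replaces [h d] below. *)
  suff : csat (dm d) (Md d) (rt d) (CEx Univ C) by [].
  apply: (type_of_csat CI td); suff : csat dom M (h d') (CEx Univ C) by [].
  by apply: (type_of_csat CI (esym td')); rewrite csat_CEx; exists m'.
- have CIC : List.In C cs by apply: I; case: (C) => *; left.
  split; rewrite ![in X in X -> _]csat_CAll => H.
    rewrite csat_CAll => m' m'M Rm; apply/(IH I _ _ dD m'M)/H; first exact: domE.
    by case: (R) Rm => //= r; apply: glue_edge_copy.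
  rewrite csat_CAll => y /glue_domP[d' [m' [d'D m'M ->]]] Rm.
  apply/(IH I _ _ d'D m'M).
  have [dom [M [h [hd hd' td td' hf]]]] := glue_pair dD d'D.
  case: R CI Rm H => [r|] CI Rm H.
    case: (glue_edge dD d'D Rm) => [[e Rm']|[em em' ff]].
      by rewrite -e in m'M *; apply: H.
    rewrite em'; apply: (type_of_csat CIC td').
    have H' : csat dom M (h d) (CAll (RName r) C).
      by apply: (type_of_csat CI (esym td)); rewrite csat_CAll -em.
    by apply: H' => //; apply: hf ff _.
  (* The type of [d] passes [CAll Univ C] to the common model, and from there it enters the type of
     [d']. *)
  have H1 : csat dom M (h d') (CAll Univ C).
    suff : csat dom M (h d) (CAll Univ C) by [].
    by apply: (type_of_csat CI (esym td)).
  by have := type_of_csat CI td' H1; apply.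
Qed.

(** Concept inclusions hold by [csat_glue]. Role axioms hold inside each copy; forced edges are
    closed under them because every good model satisfies them. *)
Lemma models_glue : models glue_dom glue O.
Proof.
have [_ glueS sub] := glue_structure.
apply/List.Forall_forall => phi pO.
have MO d : d \in adom D -> forall e, sat (dm d) (Md d) e phi.
  by move=> /Md_good[_ /List.Forall_forall]; apply.
have pS : fo_sig phi `<=` Sg.
  apply/fsubsetP => R Rp; rewrite in_fsetU; apply/orP; right.
  by apply/mem_sig; exists phi.
case: ((proj1 (List.Forall_forall _ _) OL) _ pO) => [[C [C' E]]|[R [T E]]|[R [T E]]].
- have [C1 [D1 [E1 I1 I2]]] : exists C1 D1, [/\ phi = concept_inclusion C1 D1,
      List.incl (subs C1) cs & List.incl (subs D1) cs].
    by rewrite E in pO *; apply: csP.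
  rewrite E1 in MO *; apply/sat_concept_inclusion => y /glue_domP[d [m [dD mM ->]]].
  rewrite !csat_glue //; apply: (proj1 (sat_concept_inclusion _ _ _ _)) mM.
  exact: MO.
- rewrite E in MO pS *; apply/sat_role_inclusion.
  move=> y y' /glue_domP[d [m [dD mM ->]]] /glue_domP[d' [m' [d'D m'M ->]]].
  case/(glue_edge dD d'D) => [[e RM]|[-> -> ff]].
    rewrite -e; apply: glue_edge_copy => //; rewrite -e in m'M.
    exact: (proj1 (sat_role_inclusion _ _ R T) (MO d dD)) RM.
  apply/glueP; right; rewrite !enc_root; split.
    apply/facts_overP; split=> // [|x].
      by apply: (fsubsetP pS); rewrite /= !inE eqxx orbT.
    by rewrite !inE => /orP[] /eqP ->.
  move=> dom M h gM ht hD.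
  have [hd _] : h d \in dom /\ type_of dom M (h d) = c d by apply: ht; rewrite mem_head.
  have [hd' _] : h d' \in dom /\ type_of dom M (h d') = c d'.
    by apply: ht; rewrite !inE eqxx orbT.
  have [_ /List.Forall_forall MO'] := gM.
  have MRT := proj1 (sat_role_inclusion dom M R T).
  by apply: MRT => //; [rewrite -E; apply: MO'|apply: ff gM _ _].
- rewrite E in MO pS *; apply/sat_inverse_roles.
  move=> y y' /glue_domP[d [m [dD mM ->]]] /glue_domP[d' [m' [d'D m'M ->]]].
  have inv dom M : good_model dom M -> forall x y, x \in dom -> y \in dom ->
      (role_name R, [:: x; y]) \in M <-> (role_name T, [:: y; x]) \in M.
    move=> [_ /List.Forall_forall MO'].
    by apply: (proj1 (sat_inverse_roles _ _ R T)); rewrite -E; apply: MO'.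
  (* Abstract in [r] and [s] so as to serve both directions of the equivalence. *)
  have forced_inv r s x x' : x \in adom D -> x' \in adom D -> s \in Sg -> arity s = 2 ->
      (forall dom M, good_model dom M -> forall x y, x \in dom -> y \in dom ->
        (role_name r, [:: x; y]) \in M -> (s, [:: y; x]) \in M) ->
      forced (role_name r, [:: x; x']) -> (s, [:: x'; x]) \in glue.
    move=> xD x'D sS ss rs ff; apply/glueP; right; split.
      apply/facts_overP; split=> // z.
      by rewrite !inE => /orP[] /eqP ->.
    move=> dom M h gM ht hD.
    have sym z : (z \in [:: x; x']) = (z \in [:: x'; x]) by rewrite !inE orbC.
    have [hx _] : h x \in dom /\ type_of dom M (h x) = c x.
      by apply: ht; rewrite !inE eqxx orbT.
    have [hx' _] : h x' \in dom /\ type_of dom M (h x') = c x'.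
      by apply: ht; rewrite mem_head.
    apply: (rs dom M gM (h x) (h x')) => //; apply: ff gM _ _.
      by move=> z /=; rewrite sym; apply: ht.
    by move=> g gD gs; apply: hD => // z /gs /=; rewrite sym.
  split=> [/(glue_edge dD d'D)[[e RM]|[-> -> ff]]|/(glue_edge d'D dD)[[e RM]|[-> -> ff]]].
  + by rewrite -e in m'M *; apply: glue_edge_copy => //; apply/(inv _ _ (Md_good dD)).
  + rewrite !enc_root; apply: forced_inv ff => //.
      by apply: (fsubsetP pS); rewrite /= !inE eqxx !orbT.
    by move=> dom M gM x x' xd x'd /(inv _ _ gM x x' xd x'd).
  + by rewrite e in m'M RM *; apply: glue_edge_copy => //; apply/(inv _ _ (Md_good dD)).
  + rewrite !enc_root; apply: forced_inv ff => //.
      by apply: (fsubsetP pS); rewrite /= !inE eqxx ?orbT.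
    by move=> dom M gM x x' xd x'd /(inv _ _ gM x' x x'd xd).
Qed.


(* On few elements, the glued structure maps into a local countermodel: the part
   of Z inside the model attached to d is a unary CQ belonging to the type of d. *)
Lemma glue_image Z : size Z <= cq_bound ->
  exists dom M (phi : const -> const),
    [/\ good_model dom M, ~ matches M (map_tuple phi a)
      & forall f, f \in glue -> {subset f.2 <= Z} -> inst phi f \in M].
Proof.
move=> sZ; have [d0 d0D] : exists d, d \in adom D.
  have [f fD] := fset0Pn _ D0; have [fS sz] := DS fD.
  case E: f.2 sz => [|d xs] sz; first by case: (binS fS) sz => ->.
  by exists d; apply: mem_adom fD _; rewrite E mem_head.
(* The roots of the copies that meet [Z]; [d0] only makes the list non-empty. *)
pose Y := d0 :: [seq d <- [seq (dec z).1 | z <- Z] | d \in adom D].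
have YD : {subset Y <= adom D}.
  by move=> d; rewrite inE mem_filter => /orP[/eqP ->|/andP[]].
have sY : size Y <= cq_bound.+2.
  rewrite /= ltnS (leq_trans _ (leqnSn _)) // (leq_trans _ sZ) //.
  by rewrite size_filter (leq_trans (count_size _ _)) // size_map.
have [//|//|//|dom [M [h [gM hY hf nq]]]] := @glue_local Y.
have aYD : {subset a ++ Y <= adom D}.
  by move=> d; rewrite mem_cat => /orP[/tnthP[i ->]|/YD].
(* The root becomes variable [0], any other element its position in [Z] plus one. *)
pose idx d m := if m == rt d then 0 else (index (enc d m) Z).+1.
pose part d : {fset atom} :=
  [fset inst (idx d) f | f in [fset f in Md d | all (fun m => enc d m \in Z) f.2]].
(* [part d] matches at the root of [Md d], hence belongs to the type [c d], hence matches at [h d]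
   in [M]. *)
have /choice[fd fdP] : forall d, exists f : var -> const, d \in a ++ Y ->
    f 0 = h d /\ forall t, t \in part d -> inst f t \in M.
  move=> d; case: (boolP (d \in a ++ Y)) => [dY|_]; last by exists id.
  suff: cq_test (part d) dom M (h d) by case=> f ?; exists f.
  have dD := aYD _ dY; have [_ rd tc] := rootP dD; have [_ tM] := hY _ dY.
  apply: (@type_of_cq (dm d) (Md d) (rt d)); last 1 first.
  - pose f v := if v is v'.+1 then (dec (nth 0 Z v')).2 else rt d.
    exists f; split=> // t /imfsetP[g /=]; rewrite !inE => /andP[gMd /allP gZ] ->.
    rewrite inst_comp (@eq_in_inst _ id) => [|m /gZ mZ].
      by rewrite /inst map_id -surjective_pairing.
    rewrite /= /idx; case: eqP => [-> //|_] /=.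
    by rewrite nth_index // encK.
  - apply/fsubsetP => t /imfsetP[g /=]; rewrite !inE => /andP[gMd /allP gZ] ->.
    have [gS sz] := Md_sig dD gMd; apply/facts_overP; split=> //=.
      by rewrite size_map.
    move=> _ /mapP[m /gZ mZ ->]; rewrite -[_ :: _]/(iota 0 cq_bound.+1) mem_iota /idx.
    case: eqP => //= _.
    by rewrite !add0n ltnS (leq_trans _ sZ) // index_mem.
  - by rewrite tM.
(* The maps [fd] combined over all copies. They agree with [h] on roots, which takes care of forced
   facts and of [a]. *)
pose phi z := fd (dec z).1 (idx (dec z).1 (dec z).2).
have phi_root d : d \in a ++ Y -> phi d = h d.
  move=> dY; rewrite /phi /dec aYD //= /idx eqxx.
  by case: (fdP _ dY).
exists dom, M, phi; split=> //.
  suff -> : map_tuple phi a = map_tuple h a by [].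
  apply: eq_from_tnth => i; rewrite !tnth_map phi_root //.
  by rewrite mem_cat mem_tnth.
move=> f fN fZ; case/glueP: (fN) => [[d [g [dD gMd E]]]|[/facts_overP[_ _ fD] ff]].
  (* Arities are positive, so the fact has an element in [Z], which puts [d] into [Y]. *)
  have dY : d \in a ++ Y.
    have [gS] := Md_sig dD gMd; case Eg: g.2 => [|m xs].
      by case: (Sg_binary gS) => ->.
    move=> _; have := fZ (enc d m).
    rewrite E /= Eg /= mem_head => /(_ isT) mZ.
    rewrite mem_cat inE mem_filter dD /=; apply/or3P; constructor 3.
    by apply/mapP; exists (enc d m); rewrite ?encK.
  have [_ fdM] := fdP _ dY.
  rewrite E inst_comp (@eq_in_inst _ (fd d \o idx d)) => [|m mg]; last first.
    by rewrite /= /phi encK.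
  rewrite -inst_comp; apply: fdM; apply/imfsetP; exists g => //=; rewrite !inE gMd /=.
  by apply/allP => m mg; apply: fZ; rewrite E; apply: map_f.
have fY x : x \in f.2 -> x \in a ++ Y.
  move=> xf; rewrite mem_cat inE mem_filter fD //=; apply/or3P; constructor 3.
  by apply/mapP; exists x; [apply: fZ|rewrite /dec fD].
by rewrite (@eq_in_inst _ h) => [|x /fY /phi_root //]; apply: hf.
Qed.

(** A match composed with the map of [glue_image] would be a match in a local countermodel. [Z]
    contains whole facts around the images of the variables, so that variables occurring only in
    equalities also land in the active domain. *)
Lemma glue_no_match : ~ matches glue a.
Proof.
case=> p pu [g [ga gad gat geq]].
have /choice[F FP] : forall x, exists f : fact,
    x \in cq_vars p -> f \in glue /\ g x \in f.2.
  move=> x; case: (boolP (x \in cq_vars p)) => [/gad /adomP[f fN gf]|_].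
    by exists f.
  by exists (role_name 0, [::]).
pose Z := flatten [seq (F x).2 | x <- cq_vars p].
have ZP x : x \in cq_vars p -> {subset (F x).2 <= Z}.
  by move=> xp y yF; apply/flatten_mapP; exists x.
have sZ : size Z <= cq_bound.
  apply: (@leq_trans (2 * size (cq_vars p))); last first.
    by rewrite leq_mul2l /=; apply: (@leq_bigmax_seq _ u xpredT (fun p => size (cq_vars p))).
  rewrite /Z; move: FP; elim: (cq_vars p) => //= x s IH FP.
  rewrite size_cat mulnS leq_add //; last by apply: IH => y ys; apply: FP; rewrite inE ys orbT.
  have [FN _] := FP x (mem_head _ _); have [_ /(_ _ FN) [FS ->] _] := glue_structure.
  by case: (Sg_binary FS) => ->.
have [dom [M [phi [gM nq hom]]]] := glue_image sZ; apply: nq; exists p => //.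
exists (phi \o g); split=> [i|x xp|t tp|x y xy] /=.
- by rewrite ga tnth_map.
- have [FN gF] := FP x xp; apply: mem_adom (hom _ FN (ZP _ xp)) _.
  exact: map_f.
- rewrite -inst_comp; apply: hom; first exact: gat.
  move=> _ /mapP[v vt ->]; have vp : v \in cq_vars p.
    by rewrite mem_cat (mem_atoms_vars tp vt).
  by apply: (ZP _ vp); case: (FP v vp).
- by rewrite (geq x y).
Qed.

End Glue.

Section ALCHIUToMDDlog.
Variables (S : schema) (O : ontology) (n : nat) (u : seq cq) (cs : list concept).
Hypotheses (binS : binary_schema S) (OL : ontology_in ALCHIU O).
Hypothesis csP : forall C D, List.In (concept_inclusion C D) O ->
    exists C' D', [/\ concept_inclusion C D = concept_inclusion C' D',
                     List.incl (subs C') cs & List.incl (subs D') cs].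

(** Realizing the colouring on [a] and one further element [d] at a time provides the pointed model
    that is attached to [d]. *)
Lemma local_to_global_ALCHIU :
  local_to_global S (n + (cq_bound u).+2) (good_model S O) (@matches n u)
    (type_of S O u cs).
Proof.
move=> D a c D0 DS aD loc.
have : exists R : const -> {fset const} * instance * const, forall d, d \in adom D ->
    [/\ good_model S O (R d).1.1 (R d).1.2, (R d).2 \in (R d).1.1
      & type_of S O u cs (R d).1.1 (R d).1.2 (R d).2 = c d].
  suff /choice[R RP] : forall d, exists R : {fset const} * instance * const,
    d \in adom D -> [/\ good_model S O R.1.1 R.1.2, R.2 \in R.1.1
      & type_of S O u cs R.1.1 R.1.2 R.2 = c d] by exists R.
  move=> d; case: (boolP (d \in adom D)) => [dD|_]; last by exists (fset0, fset0, 0).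
  have [|x|x xa||dom [M [h [gM hY _ _]]]] := loc (a ++ [:: d]).
  - by case: (tval a).
  - by rewrite mem_cat inE => /orP[/tnthP[i ->]|/eqP ->].
  - by rewrite mem_cat xa.
  - by rewrite size_cat size_tuple leq_add2l.
  exists (dom, M, h d) => _; have [] := hY d; last by split.
  by rewrite mem_cat mem_head orbT.
case=> R RP.
pose B := (\max_(d <- adom D) d).+1.
have B_fresh d : d \in adom D -> d < B.
  by move=> dD; rewrite ltnS; apply: (@leq_bigmax_seq _ (enum_fset (adom D)) xpredT id).
exists (glue_dom D (fun d => (R d).1.1) (fun d => (R d).2) B).
exists (glue S O u cs D c (fun d => (R d).1.2) (fun d => (R d).2) B).
split.
- split; [exact: (glue_structure binS D0 DS RP)|].
  exact: (models_glue binS OL csP D0 DS aD loc RP B_fresh).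
- exact: sub_glue.
- exact: (glue_no_match binS OL D0 DS aD loc RP B_fresh).
Qed.

End ALCHIUToMDDlog.

(** * Expressive power *)

Lemma MDDlog_expresses_ALCHIU :
  at_least_as_expressive_on [pred D | D != fset0] MDDlog (OMQ ALCHIU UCQ).
Proof.
move=> S n _ binS [O [_ [OL [u [uS ->]] ->]]].
(* Guess rules need a symbol of [S]. Over the empty schema there is no non-empty instance, and the
   empty program will do. *)
have [S0|S0] := eqVneq S fset0.
  exists (@ddlog_query (0, n) [::] n); split.
    exists (0, n), [::]; split=> //.
    - by move=> R /mem_idb[].
    - by rewrite S0; apply/fsetP => R; rewrite !inE; apply/negP => /andP[_ /mem_body_edb[]].
  by move=> D /fset0Pn[f fD] /(_ f fD)[]; rewrite S0 inE.
have [cs csP] := subs_closure OL; have [b b_fresh] := fresh_name S.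
pose good := good_model S O; pose Q := @matches n u; pose typ := type_of S O u cs.
pose L := size (tests S O u cs); pose K := n + (cq_bound u).+2.
have size_typ dom M d : size (typ dom M d) = L by apply: size_type_of.
have good_adom dom M : good dom M -> adom M `<=` dom by case=> -[].
exists (@ddlog_query (goal_sym n b) (local_program S L K good Q typ b) n); split.
  exists (goal_sym n b), (local_program S L K good Q typ b); split=> //.
  - exact: ddlog_local_program.
  - exact: monadic_local_program.
  - exact: edb_local_program.
move=> D D0 DS a; split=> [[aD H]|HP].
  apply: local_program_to_good => //.
    exact: local_to_global_ALCHIU.
  by move=> dom M [Mf MO] DM; have [] := H dom M Mf MO DM.
have [aD _] := HP; split=> // dom M Mf MO DM; split.
  by move=> i; apply: (fsubsetP (adomS DM)).
exact: (good_to_local_program binS S0 size_typ good_adom b_fresh DS HP (conj Mf MO) DM).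
Qed.

Lemma OMQ_mono (L1 L2 : ontology_language) Q : (forall phi, L1 phi -> L2 phi) ->
  at_least_as_expressive (OMQ L2 Q) (OMQ L1 Q).
Proof.
move=> L12 S n q binS [O [q' [OL Qq ->]]]; exists (certain_answers S O q').
by split=> //; exists O, q'; split=> //; apply: List.Forall_impl OL.
Qed.

Lemma ALC_ALCHIU phi : ALC phi -> ALCHIU phi.
Proof. by case=> C [D [_ _ ->]]; constructor 1; exists C, D. Qed.

Lemma MDDlog_expresses_ALC :
  at_least_as_expressive_on [pred D | D != fset0] MDDlog (OMQ ALC UCQ).
Proof.
move=> S n q binS Hq; have [q1 [Hq1 e1]] := OMQ_mono ALC_ALCHIU binS Hq.
have [q2 [Hq2 e2]] := MDDlog_expresses_ALCHIU binS Hq1.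
exists q2; split=> // D D0 DS a; rewrite (e1 D isT DS a); exact: e2.
Qed.

Lemma certain_answers_mono S O n u (D D' : instance) (a : n.-tuple const) :
  D `<=` D' -> certain_answers S O (ucq_query u) D a ->
  certain_answers S O (ucq_query u) D' a.
Proof.
move=> DD' [aD H]; split=> [i|dom M Mf MO D'M]; first exact: (fsubsetP (adomS DD')).
exact: (H dom M Mf MO (fsubset_trans DD' D'M)).
Qed.

(** Rule bodies are non-empty, so the empty instance satisfies all rules. *)
Lemma MDDlog_fset0 S n (q : query n) a : MDDlog S q -> ~ q fset0 a.
Proof.
case=> goal [P [wf _ _ _ ->]] [_ H]; have : (goal, val a) \in (fset0 : instance).
  apply: H => [f|//|r rP h hb]; first by rewrite inE.
  have [b0 _ _ _ _] := wf _ rP; case E: (rule_body r) b0 hb => [|t s] // _ /(_ t).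
  by rewrite mem_head inE => /(_ isT).
by rewrite inE.
Qed.

(** A query with an answer on the empty instance is Boolean and, by monotonicity, always true; the
    empty CQ expresses it. Any other query passes through MDDlog, both sides being false on the
    empty instance. *)
Lemma ALC_expresses_ALCHIU : at_least_as_expressive (OMQ ALC UCQ) (OMQ ALCHIU UCQ).
Proof.
move=> S n q binS Hq; have [O [_ [_ [u [_ ->]] Eq]]] := Hq.
have [[a qa]|nq] := EM (exists a, q fset0 a).
  exists (certain_answers S [::] (ucq_query [:: ([::], [::])] : query n)); split.
    do 2!eexists; split; [exact: List.Forall_nil| |by []].
    by exists [:: ([::], [::])]; split=> // p; rewrite inE => /eqP ->.
  have n0 : n = 0.
    case: n a {Hq} q Eq qa => // n a q -> [aD _].
    by have := aD ord0; rewrite adom0 inE.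
  move=> D _ DS a'; split=> _.
    split=> [[i lt]|dom M _ _ _]; first by exfalso; rewrite n0 in lt.
    split=> [[i lt]|]; first by exfalso; rewrite n0 in lt.
    exists ([::], [::]); rewrite ?mem_head //; exists (fun=> 0); split=> //.
    by case=> i lt; exfalso; rewrite n0 in lt.
  have -> : a' = a.
    by apply: eq_from_tnth => -[i lt]; exfalso; rewrite n0 in lt.
  move: qa; rewrite Eq; exact/certain_answers_mono/fsub0set.
have [q1 [Hq1 e1]] := MDDlog_expresses_ALCHIU binS Hq.
have [q2 [Hq2 e2]] := ALC_expresses_MDDlog binS Hq1.
exists q2; split=> // D _ DS a; rewrite -(e2 D isT DS a).
have [->|D0] := eqVneq D fset0; last exact: e1.
by split=> [qa|/(MDDlog_fset0 Hq1)//]; case: nq; exists a.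
Qed.

(** * Separations *)

(** A model of the program over [D1] pulls back along [h] to one over [D]; restricting it to
    [adom D] keeps it finite and loses no heads, as head variables occur in bodies. *)
Lemma ddlog_query_hom goal P n (D D1 : instance) (h : const -> const)
    (a : n.-tuple const) :
  ddlog_program goal P -> instance_over (edb P) D ->
  (forall f, f \in D -> inst h f \in D1) ->
  ddlog_query goal P D a -> ddlog_query goal P D1 (map_tuple h a).
Proof.
move=> wf DS hom [aD H]; split=> [i|D1' D1'S /fsubsetP D1D1' HP].
  rewrite tnth_map; have /adomP[f fD af] := aD i.
  by apply: mem_adom (hom _ fD) _; apply: map_f.
pose D' := [fset f in facts_over (idb P `|` edb P) (adom D) | inst h f \in D1'].
have D'E f : (f \in D') = (f \in facts_over (idb P `|` edb P) (adom D))
    && (inst h f \in D1') by rewrite !inE.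
suff : (goal, val a) \in D' by rewrite D'E => /andP[].
apply: H => [f||r rP g gb].
- by rewrite D'E => /andP[/facts_overP[]].
- apply/fsubsetP => f fD; have [fS sz] := DS _ fD.
  rewrite D'E D1D1' ?hom // andbT; apply/facts_overP; rewrite in_fsetU fS orbT.
  by split=> // x; apply: mem_adom.
have [_ hv ar _ _] := wf _ rP.
have [t tr|t tr tD1] := HP _ rP (h \o g).
  by rewrite -inst_comp; have := gb t tr; rewrite D'E => /andP[].
exists t => //; rewrite D'E inst_comp tD1 andbT; apply/facts_overP; split=> /=.
- rewrite in_fsetU; apply/orP; left; apply/mem_idb; exists r => //.
  by exists t.
- by rewrite size_map ar // mem_cat tr.
move=> _ /mapP[v vt ->]; have /flatten_mapP[s sr vs] := hv _ (mem_atoms_vars tr vt).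
have := gb s sr; rewrite D'E => /andP[/facts_overP[_ _ sub] _].
by apply: sub; apply: map_f.
Qed.

(** * Functional roles *)

Definition r0 : symbol := role_name 0.

Lemma binary_r0 : binary_schema [fset r0].
Proof. by move=> R; rewrite inE => /eqP ->; right. Qed.

(** The empty union never holds, so this is true exactly when [r0] is not functional in the data. *)
Definition functionality : query 0 :=
  certain_answers [fset r0] [:: functional_role 0] (ucq_query [::]).

(** Two edges leaving [0] violate functionality, but their homomorphic image, a loop at [0], does
    not. *)
Lemma ALC_not_expresses_ALCF : ~ at_least_as_expressive (OMQ ALC UCQ) (OMQ ALCF UCQ).
Proof.
move=> /(_ [fset r0] 0 functionality binary_r0)[|q1 [Hq1 e1]].
  exists [:: functional_role 0], (ucq_query [::]); split=> //.
    by apply: List.Forall_cons; [right; exists 0|exact: List.Forall_nil].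
  by exists [::].
have [q2 [[goal [P [wf mon ar edbS Eq]]] e2]] := MDDlog_expresses_ALC binary_r0 Hq1.
pose D : instance := [fset (r0, [:: 0; 1]); (r0, [:: 0; 2])].
pose D1 : instance := [fset (r0, [:: 0; 0])].
have DS : instance_over [fset r0] D.
  by move=> f; rewrite !inE => /orP[] /eqP ->.
have D1S : instance_over [fset r0] D1.
  by move=> f; rewrite !inE => /eqP ->.
have ne (f : fact) (X : instance) : f \in X -> [pred D | D != fset0] X.
  by move=> fX; apply/fset0Pn; exists f.
have HD : functionality D [tuple].
  split=> [[]//|dom M [_ _ /fsubsetP Md] MO /fsubsetP DM]; exfalso.
  have M1 : (r0, [:: 0; 1]) \in M by apply: DM; rewrite !inE eqxx.
  have M2 : (r0, [:: 0; 2]) \in M by apply: DM; rewrite !inE eqxx orbT.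
  have dM x y z : (r0, [:: x; y]) \in M -> z \in [:: x; y] -> z \in dom.
    by move=> fM zf; apply: Md; apply: mem_adom fM _.
  have F : forall e, sat dom M e (functional_role 0) by inversion MO.
  by have := F id 0 (dM _ _ 0 M1 isT) 1 (dM _ _ 1 M1 isT) 2 (dM _ _ 2 M2 isT) (conj M1 M2).
have : ~ functionality D1 (map_tuple (fun=> 0) ([tuple] : 0.-tuple const)).
  case=> _ /(_ [fset 0] D1)[||//|_ [p]] //.
  - split.
    + by apply/fset0Pn; exists 0; rewrite inE.
    + by move=> f /D1S[fS sz]; rewrite in_fsetU fS.
    + apply/fsubsetP => x /adomP[f]; rewrite !inE => /eqP -> /=.
      by rewrite !inE orbb.
  - apply: List.Forall_cons => [e /= x|]; last exact: List.Forall_nil.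
    by rewrite inE => /eqP -> y; rewrite inE => /eqP -> z; rewrite inE => /eqP ->.
have D0 : [pred D | D != fset0] D by apply: (ne (r0, [:: 0; 1])); rewrite !inE eqxx.
have D10 : [pred D | D != fset0] D1 by apply: (ne (r0, [:: 0; 0])); rewrite !inE eqxx.
apply; apply/(e1 D1 isT D1S)/(e2 D1 D10 D1S).
rewrite Eq; apply: (@ddlog_query_hom _ _ _ D) => //.
- by rewrite edbS.
- by move=> f; rewrite !inE => /orP[] /eqP ->; rewrite /inst /= eqxx.
by rewrite -Eq; apply/(e2 D D0 DS)/(e1 D isT DS).
Qed.

(** * Transitive roles: paths and cycles *)

Definition path_instance (N : nat) : instance :=
  [fset (r0, [:: i; i.+1]) | i in iota 0 N].
Definition cycle_instance (l : nat) : instance :=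
  [fset (r0, [:: i; i.+1 %% l]) | i in iota 0 l].

Lemma path_instanceP N f :
  reflect (exists2 i, i < N & f = (r0, [:: i; i.+1])) (f \in path_instance N).
Proof.
by apply: (iffP (imfsetP _ _ _ _)) => -[i]; rewrite /= ?mem_iota; exists i; rewrite //= mem_iota.
Qed.

Lemma cycle_instanceP l f :
  reflect (exists2 i, i < l & f = (r0, [:: i; i.+1 %% l])) (f \in cycle_instance l).
Proof.
by apply: (iffP (imfsetP _ _ _ _)) => -[i]; rewrite /= ?mem_iota; exists i; rewrite //= mem_iota.
Qed.

(* In a model over a long path, two far apart windows of k nodes look alike;
   closing up the segment between them gives a cycle on which every image of a
   rule body, missing one of its first k+1 nodes, unrolls into the path. *)
Lemma path_to_cycle goal P : ddlog_program goal P -> monadic goal P ->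
  arity goal = 0 -> edb P = [fset r0] ->
  exists N, forall a : 0.-tuple const,
    (forall l, 0 < l -> ddlog_query goal P (cycle_instance l) a) ->
    ddlog_query goal P (path_instance N.+1) a.
Proof.
move=> wf mon ar edbS.
(* Bounds the number of variable occurrences in a rule body. Below, [T] consists of the colourings
   of [k] consecutive nodes. *)
pose k := \max_(r <- P) size (atoms_vars (rule_body r)).
pose T := {ffun (idb P * 'I_k) -> bool}.
(* Room for one window more than there are colourings, at distance [k.+1] from each other, with [k]
   nodes to spare. *)
exists (#|T|.+1 * k.+1 + k) => a H; split=> [[]//|D' D'S /fsubsetP DD' HP].
apply: contrapT => /negP ga.
pose W (s : 'I_#|T|.+1) : T := 
  [ffun At : (idb P * 'I_k)%type => (val At.1, [:: s * k.+1 + At.2]) \in D'].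
have [s [s' [lt_s W_s]]] : exists s s' : 'I_#|T|.+1, s < s' /\ W s = W s'.
  have /injectivePn[s [s' ne e]] : ~~ injectiveb W.
    by apply/negP => /injectiveP /leq_card; rewrite card_ord ltnn.
  case: (ltngtP s s') => [lt|lt|/val_inj E]; first by exists s, s'.
    by exists s', s.
  by rewrite E eqxx in ne.
pose i := s * k.+1; pose j := s' * k.+1; pose l := j - i.
have ij : i + k < j by rewrite -addnS addnC -mulSn leq_mul2r.
have kl : k < l by rewrite ltn_subRL.
have jE : j = i + l by rewrite subnKC // (leq_trans (leq_addr k i)) // ltnW.
have jN : j + k < (#|T|.+1 * k.+1 + k).+1.
  by rewrite ltnS leq_add2r leq_mul2r /= ltnW.
have win A t : A \in idb P -> t < k -> ((A, [:: i + t]) \in D') = ((A, [:: j + t]) \in D').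
  move=> AP tk; have := congr1 (fun w : T => w ([` AP], Ordinal tk)) W_s.
  by rewrite !ffunE.
have rP0 : r0 \notin idb P.
  have : r0 \in edb P by rewrite edbS inE.
  by rewrite /edb in_fsetD => /andP[].
have gS : goal != r0.
  by have := goal_notin_edb wf; rewrite edbS inE.
pose C := cycle_instance l.
(* Node [x] of the cycle gets the colours of node [i + x] of the path; goal facts are left out. *)
pose E := [fset f in facts_over (idb P `\ goal) (iota 0 l) | inst (addn i) f \in D'] : instance.
have CEP f : f \in C `|` E -> f \in C \/
    exists A x, [/\ f = (A, [:: x]), A \in idb P, A != goal, x < l & (A, [:: i + x]) \in D'].
  move=> /fsetUP[|]; [by left|rewrite !inE => /andP[/facts_overP[]]].
  case: f => A xs /= /fsetD1P[Ag AP]; rewrite (mon _ AP Ag).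
  case: xs => [|x []] // _ sub fD; right; exists A, x; split=> //.
  by have := sub x (mem_head _ _); rewrite mem_iota.
have lP : 0 < l by apply: leq_ltn_trans kl.
have CE_lt f x : f \in C `|` E -> x \in f.2 -> x < l.
  case/CEP => [/cycle_instanceP[t tl ->]|[A [y [-> _ _ yl _]]]] /=.
    by rewrite !inE => /orP[] /eqP -> //; rewrite ltn_mod.
  by rewrite inE => /eqP ->.
have [_ /(_ (C `|` E))] := H l lP.
suff : (goal, val a) \notin C `|` E.
  move=> /negP nga K; apply: nga; apply: K.
  - move=> f /CEP[/cycle_instanceP[t tl ->]|[A [x [-> AP Ag _ _]]]] /=.
      by rewrite in_fsetU edbS inE eqxx orbT.
    by rewrite in_fsetU AP /= (mon _ AP Ag).
  - exact: fsubsetUl.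
  move=> r rP g gb; have [_ hv arr gnb _] := wf _ rP.
  (* At most [k] variables cannot hit all of the [k.+1] nodes up to [k]. *)
  have [z [zk zX]] : exists z, z <= k /\ z \notin map g (atoms_vars (rule_body r)).
    apply: contrapT => nz.
    have sub : {subset iota 0 k.+1 <= map g (atoms_vars (rule_body r))}.
      move=> z; rewrite mem_iota ltnS /= => zk; apply: contrapT => /negP zX.
      by apply: nz; exists z.
    have := uniq_leq_size (iota_uniq _ _) sub; rewrite size_iota size_map leqNgt.
    by rewrite ltnS (@leq_bigmax_seq _ P xpredT (fun r => size (atoms_vars (rule_body r)))).
  have gz v : v \in atoms_vars (rule_body r) -> g v != z.
    by move=> vb; apply: contraNneq zX => <-; apply: map_f.
  have gl v : v \in atoms_vars (rule_body r) -> g v < l.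
    by case/flatten_mapP => t tr vt; apply: CE_lt (gb t tr) _; apply: map_f.
  (* Cuts the cycle at [z]: nodes before [z] continue the segment in the second window, so edges
     avoiding [z] become path edges. *)
  pose unroll t := if t < z then j + t else i + t.
  (* Only nodes below [z <= k] are moved, and there the two windows agree. *)
  have col A x : A \in idb P -> ((A, [:: unroll x]) \in D') = ((A, [:: i + x]) \in D').
    rewrite /unroll => AP; case: ifP => // xz; rewrite win //.
    exact: leq_trans xz zk.
  have [t tr|t tr tD'] := HP _ rP (unroll \o g).
    rewrite -inst_comp; case/CEP: (gb t tr); last first.
      by case=> A [x [-> AP _ _]]; rewrite /inst /= -col.
    case/cycle_instanceP => x xl e; rewrite e; apply: DD'; apply/path_instanceP.
    have gzt y : y \in map g t.2 -> y != z.
      by move=> /mapP[v vt ->]; apply/gz/(mem_atoms_vars tr).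
    have e2 : map g t.2 = [:: x; x.+1 %% l] by case: e.
    have xz : x != z by apply: gzt; rewrite e2 mem_head.
    have yz : x.+1 %% l != z by apply: gzt; rewrite e2 !inE eqxx orbT.
    exists (unroll x).
      rewrite (leq_trans _ jN) // ltnS /unroll; case: ifP => [xz'|_].
        by rewrite leq_add2l ltnW // (leq_trans xz').
      by rewrite (leq_trans (ltnW _) (leq_addr _ _)) // jE ltn_add2l.
    rewrite /inst /=; congr (_, [:: _; _]); move: yz; rewrite /unroll.
    have [xl'|xl'] := ltnP x.+1 l.
      rewrite modn_small // => yz; case: (ltngtP x z) xz => // xz _.
        by rewrite ltn_neqAle yz xz addnS.
      by rewrite ltnNge (leqW (ltnW xz)) /= addnS.
    (* The closing edge: its target [0] is not [z], hence lies before it and unrolls to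
       [j = i + l]. *)
    have <- : x.+1 = l by apply/eqP; rewrite eqn_leq xl' xl.
    rewrite modnn => z0; have zx : z <= x by rewrite -ltnS (leq_trans _ xl') // (leq_ltn_trans zk).
    rewrite lt0n eq_sym z0 ltnNge zx /= addn0 jE -addnS; congr addn.
    by apply/eqP; rewrite eqn_leq xl' xl.
  have tP : t.1 \in idb P by apply/mem_idb; exists r => //; exists t.
  have sz : size t.2 = arity t.1 by rewrite arr // mem_cat tr.
  have [tg|tg] := eqVneq t.1 goal.
    case/negP: ga; move: tD'; rewrite /inst tg.
    by move: sz; rewrite tg ar (tuple0 a) => /size0nil ->.
  exists t => //; rewrite in_fsetU; apply/orP; right.
  move: sz; rewrite (mon _ tP tg); case: t tr tD' tP tg => A [|v []] // tr tD' /= AP Ag _.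
  rewrite !inE /inst /= -col //; move: tD'; rewrite /inst /= => ->; rewrite andbT.
  apply/facts_overP; split=> /=; first by rewrite in_fsetD1 Ag.
    by rewrite (mon _ AP Ag).
  move=> x; rewrite inE => /eqP ->; rewrite mem_iota /= add0n.
  by apply/gl/hv/(mem_atoms_vars tr); rewrite mem_head.
apply/negP => /CEP[/cycle_instanceP[t _ [E1]]|[A [x [[E1] _]]]].
  by rewrite E1 eqxx in gS.
by rewrite E1 eqxx.
Qed.

Definition loop_cq : cq := ([:: (r0, [:: 0; 0])], [::]).
Definition cyclicity : query 0 :=
  certain_answers [fset r0] [:: transitive_role 0] (ucq_query [:: loop_cq]).

(** Following the edges from [0], transitivity yields an edge from [0] to every node, and after [l]
    steps to [0] itself. *)
Lemma cyclicity_cycle l a : 0 < l -> cyclicity (cycle_instance l) a.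
Proof.
move=> l0; split=> [[]//|dom M [_ _ /fsubsetP Md] MO /fsubsetP DM]; split=> [[]//|].
have dM x y z : (r0, [:: x; y]) \in M -> z \in [:: x; y] -> z \in dom.
  by move=> fM zf; apply: Md; apply: mem_adom fM _.
have F : forall e, sat dom M e (transitive_role 0) by inversion MO.
have trans x y z : (r0, [:: x; y]) \in M -> (r0, [:: y; z]) \in M -> (r0, [:: x; z]) \in M.
  move=> xy yz; apply: (F id x _ y _ z) => //; first by apply: dM xy _; rewrite inE eqxx.
    by apply: dM xy _; rewrite !inE eqxx orbT.
  by apply: dM yz _; rewrite !inE eqxx orbT.
have edge x : (r0, [:: x %% l; x.+1 %% l]) \in M.
  apply: DM; apply/cycle_instanceP; exists (x %% l); first by rewrite ltn_mod.
  by rewrite -[(x %% l).+1]addn1 modnDml addn1.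
have reach x : (r0, [:: 0; x.+1 %% l]) \in M.
  elim: x => [|x IH]; first by have := edge 0; rewrite mod0n.
  exact: trans IH (edge x.+1).
exists loop_cq; first exact: mem_head.
have M00 : (r0, [:: 0; 0]) \in M.
  by have := reach l.-1; rewrite prednK // modnn.
exists (fun=> 0); split=> [[]//|x _|t|//]; first exact: mem_adom M00 (mem_head _ _).
by rewrite inE => /eqP ->.
Qed.

(** The strict order on the nodes is transitive, contains the path and has no loop. *)
Lemma cyclicity_path N a : ~ cyclicity (path_instance N.+1) a.
Proof.
pose M : instance := [fset f in facts_over [fset r0] (iota 0 N.+2) |
                       nth 0 f.2 0 < nth 0 f.2 1].
have iE z : (z \in iota 0 N.+2) = (z < N.+2) by rewrite mem_iota.
have ME x y : ((r0, [:: x; y]) \in M) = [&& x < N.+2, y < N.+2 & x < y].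
  rewrite !inE /= andbA; congr andb; apply/facts_overP/andP => [[_ _ sub]|[xN yN]].
    have lt z : z \in [:: x; y] -> z < N.+2 by move/sub; rewrite -iE.
    by split; apply: lt; rewrite !inE eqxx ?orbT.
  split=> //= [|z]; first by rewrite inE.
  rewrite -[X in _ -> X]/(is_true (z \in iota 0 N.+2)) iE !inE.
  by case/orP => /eqP ->.
case=> _ /(_ (0 |` adom M) M)[|||].
- split.
  + by apply/fset0Pn; exists 0; rewrite !inE.
  + move=> f; rewrite !inE => /andP[/facts_overP[/fset1P -> sz _] _].
    by rewrite sz eqxx.
  + exact: fsubsetUr.
- apply: List.Forall_cons => [e x _ y _ z _ /=|]; last exact: List.Forall_nil.
  case; rewrite /inst /upd /= !ME => /and3P[xN _ xy] /and3P[_ zN yz].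
  by rewrite xN zN (ltn_trans xy yz).
- apply/fsubsetP => f /path_instanceP[x xN ->].
  by rewrite ME (leq_trans xN) //= ltnS xN leqnn.
by move=> _ [p]; rewrite inE => /eqP -> [h [_ _ /(_ _ (mem_head _ _))]];
  rewrite /inst /= ME ltnn !andbF.
Qed.

(** An equivalent program would hold on all cycles, hence by [path_to_cycle] on some path, where
    [cyclicity] fails. *)
Lemma ALC_not_expresses_S : ~ at_least_as_expressive (OMQ ALC UCQ) (OMQ DL_S UCQ).
Proof.
move=> /(_ [fset r0] 0 cyclicity binary_r0)[|q1 [Hq1 e1]].
  exists [:: transitive_role 0], (ucq_query [:: loop_cq]); split=> //.
    by apply: List.Forall_cons; [right; exists 0|exact: List.Forall_nil].
  exists [:: loop_cq]; split=> // p; rewrite inE => /eqP -> t; rewrite inE => /eqP ->.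
  by split; rewrite // in_fsetU inE eqxx.
have [q2 [[goal [P [wf mon ar edbS Eq]]] e2]] := MDDlog_expresses_ALC binary_r0 Hq1.
have [N HN] := path_to_cycle wf mon ar edbS.
have ne (f : fact) (X : instance) : f \in X -> [pred D | D != fset0] X.
  by move=> fX; apply/fset0Pn; exists f.
have pS : instance_over [fset r0] (path_instance N.+1).
  by move=> f /path_instanceP[x _ ->]; rewrite inE.
have p0 : [pred D | D != fset0] (path_instance N.+1).
  by apply: (ne (r0, [:: 0; 1])); apply/path_instanceP; exists 0.
apply: (@cyclicity_path N [tuple]); apply/(e1 _ isT pS)/(e2 _ p0 pS).
rewrite Eq; apply: HN => l l0.
have cS : instance_over [fset r0] (cycle_instance l).
  by move=> f /cycle_instanceP[x _ ->]; rewrite inE.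
have c0 : [pred D | D != fset0] (cycle_instance l).
  by apply: (ne (r0, [:: 0; 1 %% l])); apply/cycle_instanceP; exists 0.
by rewrite -Eq; apply/(e2 _ c0 cS)/(e1 _ isT cS); apply: cyclicity_cycle.
Qed.

Theorem theorem3 :
  (same_expressive_power_nonempty (OMQ ALCHIU UCQ) MDDlog /\
   same_expressive_power (OMQ ALCHIU UCQ) (OMQ ALC UCQ)) /\
  (strictly_more_expressive (OMQ DL_S UCQ) (OMQ ALC UCQ) /\
   strictly_more_expressive (OMQ ALCF UCQ) (OMQ ALC UCQ)).
Proof.
split; split; split.
- exact: MDDlog_expresses_ALCHIU.
- move=> S n q binS /(ALC_expresses_MDDlog binS)[q1 [Hq1 e1]].
  have [q2 [Hq2 e2]] := OMQ_mono ALC_ALCHIU binS Hq1.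
  by exists q2; split=> // D _ DS a; rewrite (e1 D isT DS a); apply: e2.
- exact: ALC_expresses_ALCHIU.
- exact/OMQ_mono/ALC_ALCHIU.
- by apply: OMQ_mono => phi; left.
- exact: ALC_not_expresses_S.
- by apply: OMQ_mono => phi; left.
- exact: ALC_not_expresses_ALCF.
Qed.
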